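(* Let $\bar\ell:\mathbb{R}^d\to\mathbb{R}$ be twice continuously differentiable and $\delta$-strongly convex for some $\delta>0$, i.e. $\nabla^2\bar\ell(\theta)\succcurlyeq\delta I$ for all $\theta\in\mathbb{R}^d$, and let $p(\theta\mid\mathcal{D})\propto e^{-\bar\ell(\theta)}$ be the corresponding posterior density. For $\tau=(m,C)\in\Omega$ let $q_\tau=\mathcal{N}(m,CC^\top)$, and let $\tau_*=(m_*,C_* )\in\Omega$ be the minimizer of $\tau\mapsto\mathrm{KL}[q_\tau\,\|\,p(\cdot\mid\mathcal{D})]$ over $\Omega$. Let $\tau_t=(m_t,C_t)\in\Omega$, $t\ge 0$, be a solution of the natural-gradient flow $$\frac{dC_t}{dt}=C_t\,\mathrm{tril}\big[I-C_t^\top H_tC_t\big],\qquad \frac{dm_t}{dt}=-C_tC_t^\top g_t,$$ where $g_t=\mathbb{E}_{\theta\sim\mathcal{N}(m_t,C_tC_t^\top)}[\nabla\bar\ell(\theta)]$ and $H_t=\mathbb{E}_{\theta\sim\mathcal{N}(m_t,C_tC_t^\top)}[\nabla^2\bar\ell(\theta)]$. Assume that there are constants $0<\xi_l\le\xi_u<\infty$ and $\lambda_{\min}>0$ such that $\xi_l\le\|C_t\|_F\le\xi_u$ and $V_t:=C_tC_t^\top\succcurlyeq\lambda_{\min}I$ for all $t\ge0$. Put $$\mu=\delta\,\min\Big\{\lambda_{\min},\frac{\lambda_{\min}^2}{2}\Big\}.$$ Then for all $t\ge 0$, $$\mathrm{KL}\big[q_{\tau_t}\,\|\,p(\cdot\mid\mathcal{D})\big]-\mathrm{KL}\big[q_{\tau_*}\,\|\,p(\cdot\mid\mathcal{D})\big]\le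 e^{-2\mu t}\Big(\mathrm{KL}\big[q_{\tau_0}\,\|\,p(\cdot\mid\mathcal{D})\big]-\mathrm{KL}\big[q_{\tau_*}\,\|\,p(\cdot\mid\mathcal{D})\big]\Big).$$
   Context: $\Omega$ is the set of pairs $(m,C)$ with $m\in\mathbb{R}^d$ and $C\in\mathbb{R}^{d\times d}$ lower triangular with positive diagonal entries (so $V=CC^\top\succ0$). For a square matrix $A$, $\mathrm{tril}[A]$ is the lower-triangular matrix with entries $A_{ij}$ for $i>j$, $\tfrac12A_{ii}$ for $i=j$, and $0$ for $i<j$. $\|\cdot\|_F$ is the Frobenius norm, $\succcurlyeq$ the Loewner order, and $\mathrm{KL}[q\|p]=\int q\log(q/p)$. The function $\bar\ell$ is the negative log-likelihood plus the negative log-prior, so that $p(\theta\mid\mathcal{D})=e^{-\bar\ell(\theta)}/Z$ with $Z=\int e^{-\bar\ell}$. All expectations appearing are assumed finite. *)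

(* Defs.v *)
From HB Require Import structures.
From mathcomp Require Import all_boot all_order all_algebra.
From mathcomp Require Import all_classical all_reals all_analysis.

Set Implicit Arguments.
Unset Strict Implicit.
Unset Printing Implicit Defensive.

Import Order.TTheory GRing.Theory Num.Theory.
Import numFieldNormedType.Exports.

Local Open Scope classical_set_scope.
Local Open Scope ring_scope.

(* ['cV[R]_n] carries the product sigma-algebra, generated by the coordinates
   (which is the Borel sigma-algebra of R^n). *)
Definition cV_display : measure_display. Proof. by []. Qed.

Section measurable_cV.
Variables (R : realType) (n : nat).

Let coor (i : 'I_n) (x : 'cV[R]_n) : R := x i 0.

Let cV_set0 : g_sigma_preimage coor set0.
Proof. exact: sigma_algebra0. Qed.

Let cV_setC A : g_sigma_preimage coor A -> g_sigma_preimage coor (~` A).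
Proof. exact: sigma_algebraC. Qed.

Let cV_bigcup (F : _^nat) : (forall i, g_sigma_preimage coor (F i)) ->
  g_sigma_preimage coor (\bigcup_i (F i)).
Proof. exact: sigma_algebra_bigcup. Qed.

HB.instance Definition _ := @isMeasurable.Build cV_display
  'cV[R]_n (g_sigma_preimage coor) cV_set0 cV_setC cV_bigcup.

Lemma measurable_coord (i : 'I_n) :
  measurable_fun [set: 'cV[R]_n] (fun x : 'cV[R]_n => x i 0).
Proof.
move=> _ Y mY; rewrite setTI; apply: sub_sigma_algebra => /=.
rewrite -bigcup_seq/=; exists i => /=; first by rewrite mem_index_enum.
by exists Y => //; rewrite setTI.
Qed.

End measurable_cV.

Section lebesgue_cV.
Variable R : realType.

Lemma measurable_fun_cVP d (T : measurableType d) n (f : T -> 'cV[R]_n) :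
  (forall i, measurable_fun [set: T] (fun x => f x i 0)) ->
  measurable_fun [set: T] f.
Proof.
move=> mf _ Y mY; rewrite setTI.
suff : <<s \big[setU/set0]_(i < n)
    preimage_set_system setT (fun x : 'cV[R]_n => x i 0) measurable >> `<=`
    [set A | measurable (f @^-1` A)] by apply.
apply: smallest_sub.
  split=> /= [|A mA|F mF].
  - by rewrite preimage_set0.
  - by rewrite setTD -preimage_setC; exact: measurableC.
  - by rewrite preimage_bigcup; exact: bigcup_measurable.
rewrite -bigcup_seq => _ [i _] [B mB <-] /=.
by rewrite setTI -[X in measurable X]setTI; exact: mf.
Qed.

Definition cV_cons n (p : R * 'cV[R]_n) : 'cV[R]_n.+1 :=
  col_mx (p.1%:M : 'cV[R]_1) p.2.

Lemma cV_cons0 n (p : R * 'cV[R]_n) : cV_cons p ord0 0 = p.1.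
Proof.
rewrite /cV_cons (_ : ord0 = lshift n (0 : 'I_1)); last exact/val_inj.
by rewrite (@col_mxEu _ 1) !mxE eqxx.
Qed.

Lemma cV_consS n (p : R * 'cV[R]_n) i : cV_cons p (lift ord0 i) 0 = p.2 i 0.
Proof. by rewrite /cV_cons -rshift1 (@col_mxEd _ 1). Qed.

Lemma measurable_cV_cons n : measurable_fun [set: R * 'cV[R]_n] (@cV_cons n).
Proof.
apply: measurable_fun_cVP => i; case: (unliftP ord0 i) => [j ->|->].
- under eq_fun do rewrite cV_consS.
  exact: (measurableT_comp (measurable_coord j) measurable_snd).
- under eq_fun do rewrite cV_cons0.
  exact: measurable_fst.
Qed.

Definition cV_uncons n (x : 'cV[R]_n.+1) : R * 'cV[R]_n :=
  (x ord0 0, \col_i x (lift ord0 i) 0).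

Lemma measurable_cV_uncons n : measurable_fun [set: 'cV[R]_n.+1] (@cV_uncons n).
Proof.
apply/measurable_fun_pairP; split; first exact: measurable_coord.
apply: measurable_fun_cVP => i /=.
under eq_fun do rewrite /= mxE.
exact: measurable_coord.
Qed.

Lemma cV_consK n : cancel (@cV_cons n) (@cV_uncons n).
Proof.
move=> p; rewrite /cV_uncons cV_cons0 [RHS]surjective_pairing; congr pair.
by apply/matrixP => i j; rewrite mxE cV_consS ord1.
Qed.

Definition lebesgue_cons n (mu : {sigma_finite_measure set 'cV[R]_n -> \bar R})
    : set 'cV[R]_n.+1 -> \bar R :=
  pushforward (@lebesgue_measure R \x mu)%E (@cV_cons n).

Section lebesgue_cons_measure.
Variables (n : nat) (mu : {sigma_finite_measure set 'cV[R]_n -> \bar R}).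

Let lebesgue_cons0 : lebesgue_cons mu set0 = 0%E.
Proof. by rewrite /lebesgue_cons /pushforward preimage_set0 measure0. Qed.

Let lebesgue_cons_ge0 A : (0 <= lebesgue_cons mu A)%E.
Proof. by rewrite /lebesgue_cons /pushforward; exact: measure_ge0. Qed.

Let measurable_preimage A :
  measurable A -> measurable (@cV_cons n @^-1` A).
Proof.
by move=> mA; rewrite -[X in measurable X]setTI; exact: measurable_cV_cons.
Qed.

Let lebesgue_cons_sigma_additive : semi_sigma_additive (lebesgue_cons mu).
Proof.
move=> F mF tF mUF; rewrite /lebesgue_cons /pushforward preimage_bigcup.
apply: measure_semi_sigma_additive.
- by move=> k; exact: measurable_preimage.
- apply/trivIsetP => /= i j _ _ ij; rewrite -preimage_setI.
  by move/trivIsetP : tF => /(_ _ _ _ _ ij) ->//; rewrite preimage_set0.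
- by rewrite -preimage_bigcup; exact: measurable_preimage.
Qed.

HB.instance Definition _ := isMeasure.Build _ _ _ (lebesgue_cons mu)
  lebesgue_cons0 lebesgue_cons_ge0 lebesgue_cons_sigma_additive.

Let product_sigma_finite : sigma_finite setT (@lebesgue_measure R \x mu)%E.
Proof.
have /sigma_finiteP[F [TF ndF Foo]] := sigma_finiteT (@lebesgue_measure R).
have /sigma_finiteP[G [TG ndG Goo]] := sigma_finiteT mu.
exists (fun k => F k `*` G k).
  rewrite -setXTT TF TG predeqE => -[x y]; split.
    move=> [/= [k _ Fkx] [j _ Gjy]]; exists (maxn k j) => //; split.
    - by move: x Fkx; exact/subsetPset/ndF/leq_maxl.
    - by move: y Gjy; exact/subsetPset/ndG/leq_maxr.
  by move=> [k _ []/= ? ?]; split; exists k.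
move=> k; have [? ?] := Foo k; have [? ?] := Goo k.
split; first exact: measurableX.
by rewrite product_measure1E// lte_mul_pinfty// ge0_fin_numE.
Qed.

Let lebesgue_cons_sigma_finite : sigma_finite setT (lebesgue_cons mu).
Proof.
have [F TF mF] := product_sigma_finite.
exists (fun k => @cV_uncons n @^-1` F k) => [|k].
  by rewrite -preimage_bigcup -TF preimage_setT.
have [mFk Fkoo] := mF k; split.
  by rewrite -[X in measurable X]setTI; exact: measurable_cV_uncons.
rewrite /lebesgue_cons /pushforward -comp_preimage.
by rewrite (_ : _ \o _ = id) ?preimage_id//; apply/funext; exact: cV_consK.
Qed.

HB.instance Definition _ := Measure_isSigmaFinite.Build _ _ _
  (lebesgue_cons mu) lebesgue_cons_sigma_finite.

End lebesgue_cons_measure.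

(* d-dimensional Lebesgue measure, as the iterated product of the
   one-dimensional one; [lebesgue_cV_box] gives its value on boxes. *)
Fixpoint lebesgue_cV n : {sigma_finite_measure set 'cV[R]_n -> \bar R} :=
  match n with
  | 0 => \d_(0 : 'cV[R]_0)
  | n'.+1 => lebesgue_cons (lebesgue_cV n')
  end.

Lemma lebesgue_cV_box n (A : 'I_n -> set R) : (forall i, measurable (A i)) ->
  lebesgue_cV n [set x : 'cV[R]_n | forall i, A i (x i 0)] =
  (\prod_(i < n) lebesgue_measure (A i))%E.
Proof.
elim: n A => [|n IHn] A mA.
  rewrite big_ord0 /= diracE mem_set//=; by case.
rewrite big_ord_recl -IHn//= /lebesgue_cons /pushforward.
rewrite -product_measure1E//; last first.
  rewrite (_ : mkset _ = \bigcap_(i in [set: 'I_n])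
     ((fun x : 'cV[R]_n => x i 0) @^-1` A (lift ord0 i))).
    apply: fin_bigcap_measurable => // i _.
    by rewrite -[X in measurable X]setTI; exact: measurable_coord.
  by apply/seteqP; split=> x /= h i; [move=> _|]; exact: h.
  exact: mA.
congr (product_measure1 _ _ _); apply/seteqP; split=> p /=.
  move=> h; split=> [|i]; first by have := h ord0; rewrite cV_cons0.
  by have := h (lift ord0 i); rewrite cV_consS.
move=> [h0 h] i; case: (unliftP ord0 i) => [j ->|->].
  by rewrite cV_consS.
by rewrite cV_cons0.
Qed.

End lebesgue_cV.

Section calculus.
Variables (R : realType) (d : nat).
Implicit Types (f : 'cV[R]_d -> R) (x : 'cV[R]_d).

Definition grad f x : 'cV[R]_d := \col_i 'D_(delta_mx i 0) f x.

Definition hess f x : 'M[R]_d :=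
  \matrix_(i, j) 'D_(delta_mx j 0) (fun y => grad f y i 0) x.

Definition twice_continuously_differentiable f :=
  [/\ forall x, differentiable f x,
      forall x, differentiable (grad f) x &
      continuous (hess f)].

End calculus.

(* Derivative of a curve defined on [0, +oo[: two-sided for [0 < t] and
   one-sided at [t = 0]; the values of [c] at negative times are irrelevant. *)
Definition has_derive_nneg (R : realType) (V : normedModType R)
    (c : R -> V) (t : R) (v : V) :=
  h^-1 *: (c (t + h) - c t) @[h --> within [set h | 0 <= t + h] (0 : R)^'] --> v.

Section matrices.
Variables (R : realType) (d : nat).
Implicit Types A B : 'M[R]_d.

Definition psd A := A^T = A /\ forall u : 'cV[R]_d, 0 <= (u^T *m A *m u) 0 0.

Definition loewner_ge A B := psd (A - B).

Definition frobenius A : R := Num.sqrt (\sum_i \sum_j A i j ^+ 2).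

Definition tril A : 'M[R]_d :=
  \matrix_(i, j) if (j < i)%N then A i j
                 else if i == j then A i j / 2 else 0.

(* [is_trig_mx] is lower triangularity. *)
Definition Omega (tau : 'cV[R]_d * 'M[R]_d) : Prop :=
  is_trig_mx tau.2 /\ forall i, 0 < tau.2 i i.

End matrices.

Section gaussian_variational.
Variables (R : realType) (d : nat).
Implicit Types (tau : 'cV[R]_d * 'M[R]_d) (q p lbar f : 'cV[R]_d -> R).

Definition gauss_pdf (m : 'cV[R]_d) (V : 'M[R]_d) (x : 'cV[R]_d) : R :=
  (Num.sqrt ((2 * pi) ^+ d * \det V))^-1 *
  expR (- ((x - m)^T *m invmx V *m (x - m)) 0 0 / 2).

Definition gauss tau : 'cV[R]_d -> R := gauss_pdf tau.1 (tau.2 *m tau.2^T).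

Definition posterior lbar (x : 'cV[R]_d) : R :=
  expR (- lbar x) / \int[lebesgue_cV R d]_y expR (- lbar y).

(* In the next four definitions [q] and [p] are densities with respect to
   [lebesgue_cV]. *)
Definition has_expectation q f : Prop :=
  (lebesgue_cV R d).-integrable setT (fun x => (q x * f x)%:E).

Definition expectation q f : R := \int[lebesgue_cV R d]_x (q x * f x).

Definition KL q p : \bar R :=
  (\int[lebesgue_cV R d]_x (q x * ln (q x / p x))%:E)%E.

Definition KL_finite q p : Prop := has_expectation q (fun x => ln (q x / p x)).

Definition expected_grad lbar tau : 'cV[R]_d :=
  \col_i expectation (gauss tau) (fun x => grad lbar x i 0).

Definition expected_hess lbar tau : 'M[R]_d :=
  \matrix_(i, j) expectation (gauss tau) (fun x => hess lbar x i j).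

End gaussian_variational.

(* Main.v *)
(* Write F(m, C) = KL[N(m, C C^T) || p] as
   -ln det C + E[lbar(m + C z)] + const with z standard normal. As lbar is
   delta-strongly convex and C is lower triangular, F is delta-strongly convex in
   (m, C); its gradient is expressed by g and H through Stein's identity (an
   integration by parts, itself a consequence of translation invariance).
   Differentiation under the integral is avoided: the convexity inequality at
   time t already bounds the left Dini derivative of t |-> F(m_t, C_t) by
   -D_t, with D_t = g^T V g + sum_{i>j} S_ij^2 + 1/2 sum_i S_ii^2 and
   S = C^T H C - I, and it makes F right upper semicontinuous along the flow.
   The Polyak-Lojasiewicz inequality 2 a (F - F_* ) <= D, with a = delta lambda,
   then gives the rate 2 a >= 2 mu. Strong convexity alone loses a factor 2 in the
   diagonal entries of C; the logarithmic barrier -ln det C makes up for it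
   as long as a <= 1, and a > 1 is impossible because D would then stay bounded
   away from 0 along the flow. *)
Require Import Defs.
From HB Require Import structures.
From mathcomp Require Import all_boot all_order all_algebra.
From mathcomp Require Import all_classical all_reals all_analysis.
From mathcomp Require Import measurable_realfun ring lra.

Set Implicit Arguments.
Unset Strict Implicit.
Unset Printing Implicit Defensive.

Import Order.TTheory GRing.Theory Num.Theory.
Import numFieldNormedType.Exports.

Local Open Scope classical_set_scope.
Local Open Scope ring_scope.

(* [Defs.expectation] is shadowed by the one of [probability]. *)
Local Notation expectation := Defs.expectation.

(** * Change of variables and integration by parts *)

(** Only finiteness is assumed: of the divergence on [Omega], and of g and H along the flow. No
    dominating function is at hand, and integrability of z_j times a partial derivative of [lbar] is
    not given. So integrability and slopes alike are extracted from convexity inequalities between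
    finite free energies at nearby parameters. These parameters must stay in [Omega], which reaches
    only the entries (k, j) with j <= k; pairings with lower triangular directions see no others.
    The rate comes from relative coordinates C' = C (I + X). There ln det changes by the sum of the
    ln (1 + X_ii), and V >= lambda turns delta |C X|^2 into at least a |X|^2, so the
    Polyak-Lojasiewicz inequality splits into scalar problems, one per entry. Completing the square
    settles all but the diagonal ones. *)

Section affine_change_of_variables.
Variable R : realType.

(** The measure sending [A] to [c] times the Lebesgue measure of its preimage under
    [x |-> c * x + b] agrees with Lebesgue measure on the intervals []x, y]], hence everywhere. *)
Lemma ge0_integral_affine (c b : R) (f : R -> \bar R) : 0 < c ->
  measurable_fun [set: R] f -> (forall x, (0 <= f x)%E) ->
  (\int[lebesgue_measure]_x f x =
   c%:E * \int[lebesgue_measure]_x f (c * x + b)%R)%E.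
Proof.
move=> c0 mf f0.
pose g x : R := c * x + b.
have mg : measurable_fun [set: measurableTypeR R] (g : _ -> measurableTypeR R).
  by apply: measurable_funD => //; apply: measurable_funM.
pose cn : {nonneg R} := NngNum (ltW c0).
have := @ge0_integral_pushforward _ _ (measurableTypeR R) (measurableTypeR R) R
  g mg lebesgue_measure setT f
  measurableT mf (fun x _ => f0 x).
rewrite preimage_setT /comp => <-.
rewrite -[c%:E]/(cn%:num%:E)%E -ge0_integral_mscale //.
apply: eq_measure_integral => A mA _.
  apply: lebesgue_measure_unique => // _ [[x y] _ <-] /=.
  rewrite /mscale /= /pushforward.
  rewrite (_ : g @^-1` _ = `](x - b) / c, (y - b) / c]%classic); last first.
    apply/seteqP; split=> z /=; rewrite !in_itv /= /g.
      by rewrite ltr_pdivrMr// ler_pdivlMr// ltrBlDr lerBrDr (mulrC z).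
    by rewrite ltr_pdivrMr// ler_pdivlMr// ltrBlDr lerBrDr (mulrC z).
  rewrite !lebesgue_measure_itv /= !lte_fin ltr_pM2r ?invr_gt0// ltrD2r.
  case: ifPn => _; last by rewrite mule0.
  rewrite -EFinB -EFinM; congr (_%:E); field; exact: lt0r_neq0.
Qed.

Lemma ge0_integral_cV_cons n (f : 'cV[R]_n.+1 -> \bar R) :
  measurable_fun [set: 'cV[R]_n.+1] f -> (forall x, (0 <= f x)%E) ->
  (\int[lebesgue_cV R n.+1]_x f x =
   \int[lebesgue_measure]_x \int[lebesgue_cV R n]_y f (cV_cons (x, y)))%E.
Proof.
move=> mf f0; rewrite ge0_integral_pushforward //=; last exact: measurable_cV_cons.
rewrite preimage_setT.
apply: (@fubini_tonelli1 _ _ _ _ R lebesgue_measure (lebesgue_cV R n)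
  (f \o @cV_cons R n)) => //=.
by apply: measurableT_comp => //; exact: measurable_cV_cons.
Qed.

(** Triangularity makes the first coordinate depend on [x] alone and the others on a triangular map
    of [y], shifted by an amount depending on [x]: the shape in which Tonelli's theorem allows an
    induction on the dimension. *)
Lemma affine_cV_cons n (m : 'cV[R]_n.+1) (C : 'M[R]_n.+1) x y : is_trig_mx C ->
  m + C *m cV_cons (x, y) =
  cV_cons (C ord0 ord0 * x + m ord0 0,
    (\col_i (m (lift ord0 i) 0 + C (lift ord0 i) ord0 * x))
    + (\matrix_(i, j) C (lift ord0 i) (lift ord0 j)) *m y).
Proof.
move=> /is_trig_mxP tC; apply/matrixP => i j.
rewrite (ord1 j); case: (unliftP ord0 i) => [k ->|->].
  rewrite cV_consS [LHS]mxE [X in _ + X]mxE big_ord_recl cV_cons0 !mxE addrA.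
  by congr (_ + _); apply: eq_bigr => l _; rewrite cV_consS !mxE.
rewrite cV_cons0 [LHS]mxE [X in _ + X]mxE big_ord_recl cV_cons0 /=.
by rewrite big1 ?addr0 1?addrC// => k _; rewrite tC ?mul0r.
Qed.

Lemma measurable_affine_cV n (m : 'cV[R]_n) (C : 'M[R]_n) :
  measurable_fun [set: 'cV[R]_n] (fun x : 'cV[R]_n => m + C *m x).
Proof.
apply: measurable_fun_cVP => i.
under eq_fun do rewrite !mxE.
apply: measurable_funD => //; apply: measurable_sum => j.
by apply: measurable_funM => //; exact: measurable_coord.
Qed.

Lemma ge0_integral_affine_cV n (m : 'cV[R]_n) (C : 'M[R]_n)
    (f : 'cV[R]_n -> \bar R) :
  is_trig_mx C -> (forall i, 0 < C i i) ->
  measurable_fun [set: 'cV[R]_n] f -> (forall x, (0 <= f x)%E) ->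
  (\int[lebesgue_cV R n]_x f x =
   (\prod_i C i i)%:E * \int[lebesgue_cV R n]_x f (m + C *m x)%R)%E.
Proof.
elim: n m C f => [|n IHn] m C f tC C0 mf f0.
  rewrite big_ord0 mul1e; apply: eq_integral => x _; congr f.
  by apply/matrixP => -[].
rewrite ge0_integral_cV_cons // [X in (_ * X)%E]ge0_integral_cV_cons //; last first.
  by apply: measurableT_comp => //; exact: measurable_affine_cV.
pose C' : 'M[R]_n := \matrix_(i, j) C (lift ord0 i) (lift ord0 j).
have tC' : is_trig_mx C'.
  apply/is_trig_mxP => i j ij; rewrite mxE; move/is_trig_mxP : tC; apply.
  by rewrite /= /bump /= !add1n.
have C'0 i : 0 < C' i i by rewrite mxE.
have mfc : measurable_fun [set: R * 'cV[R]_n] (f \o @cV_cons R n).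
  by apply: measurableT_comp => //; exact: measurable_cV_cons.
pose G x := (\int[lebesgue_cV R n]_y f (cV_cons (x, y)))%E.
have mG : measurable_fun [set: R] G.
  by apply: (measurable_fun_fubini_tonelli_F (f \o @cV_cons R n)) => /=.
have G0 x : (0 <= G x)%E by apply: integral_ge0.
rewrite big_ord_recl EFinM -muleA -/(G _).
rewrite (@ge0_integral_affine (C ord0 ord0) (m ord0 0) G) //.
congr (_ * _)%E.
have P0 : 0 <= \prod_(i < n) C (lift ord0 i) (lift ord0 i).
  by apply: prodr_ge0 => i _; exact: ltW.
rewrite -ge0_integralZl//; last 2 first.
- apply: (measurable_fun_fubini_tonelli_F
    (fun p : R * 'cV[R]_n => f (m + C *m cV_cons p))%R) => //.
  apply: measurableT_comp => //.
  apply: (measurableT_comp (@measurable_affine_cV _ m C)).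
  exact: measurable_cV_cons.
- by move=> x _; exact: integral_ge0.
apply: eq_integral => x _.
(* The shift varies with [x], but the induction hypothesis covers every shift and its factor does
   not involve [x]. *)
rewrite /G (IHn (\col_i (m (lift ord0 i) 0 + C (lift ord0 i) ord0 * x)) C') //.
- congr (_%:E * _)%E; first by apply: eq_bigr => i _; rewrite mxE.
  by apply: eq_integral => y _; rewrite affine_cV_cons.
- apply: measurableT_comp => //; apply: measurableT_comp; last exact: pair1_measurable.
  exact: measurable_cV_cons.
Qed.

Lemma integrable_affine_cV n (m : 'cV[R]_n) (C : 'M[R]_n) (f : 'cV[R]_n -> R) :
  is_trig_mx C -> (forall i, 0 < C i i) ->
  (lebesgue_cV R n).-integrable setT (EFin \o f) ->
  (lebesgue_cV R n).-integrable setT (fun x => (f (m + C *m x))%:E).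
Proof.
move=> tC C0 /integrableP[mf foo]; apply/integrableP; split.
  by apply: (measurableT_comp mf); exact: measurable_affine_cV.
move: foo; rewrite (@ge0_integral_affine_cV _ m C) //; last exact: measurableT_comp.
have P0 : 0 < \prod_i C i i by apply: prodr_gt0 => i _.
set I := integral _ _ _ => Ioo.
rewrite ltNge leye_eq; apply/eqP => Iy; move: Ioo.
by rewrite /I [X in (_ * X)%E]Iy gt0_muley ?lte_fin // ltxx.
Qed.

Lemma integral_affine_cV n (m : 'cV[R]_n) (C : 'M[R]_n) (f : 'cV[R]_n -> R) :
  is_trig_mx C -> (forall i, 0 < C i i) ->
  (lebesgue_cV R n).-integrable setT (EFin \o f) ->
  (\int[lebesgue_cV R n]_x (f x)%:E =
   (\prod_i C i i)%:E * \int[lebesgue_cV R n]_x (f (m + C *m x)%R)%:E)%E.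
Proof.
move=> tC C0 If.
have P0 : 0 < \prod_i C i i by apply: prodr_gt0 => i _.
have If' := integrable_affine_cV m tC C0 If.
have mf := measurable_int _ If.
have Ip := ge0_integral_affine_cV m tC C0 (measurable_funepos mf)
  (funepos_ge0 (EFin \o f)).
have In := ge0_integral_affine_cV m tC C0 (measurable_funeneg mf)
  (funeneg_ge0 (EFin \o f)).
transitivity ((\int[lebesgue_cV R n]_x (EFin \o f)^\+ x)
  - (\int[lebesgue_cV R n]_x (EFin \o f)^\- x))%E.
  exact: integralE.
have Ep : (\int[lebesgue_cV R n]_x (EFin \o f)^\+ (m + C *m x)%R =
    \int[lebesgue_cV R n]_x (fun x => (f (m + C *m x)%R)%:E)^\+ x)%E.
  by apply: eq_integral => x _; rewrite !funeposE.
have En : (\int[lebesgue_cV R n]_x (EFin \o f)^\- (m + C *m x)%R =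
    \int[lebesgue_cV R n]_x (fun x => (f (m + C *m x)%R)%:E)^\- x)%E.
  by apply: eq_integral => x _; rewrite !funenegE.
rewrite Ip In Ep En -muleBr //; first by congr (_ * _)%E; exact/esym/integralE.
exact/fin_num_adde_defr/(integrable_pos_fin_num measurableT If').
Qed.

End affine_change_of_variables.

Section divergence.
Variables (R : realType) (n : nat).
Local Notation mu := (lebesgue_cV R n).

Lemma prod_diag_scalar_mx : \prod_i (1%:M : 'M[R]_n) i i = 1.
Proof. by rewrite big1 // => i _; rewrite mxE eqxx. Qed.

Lemma integrable_translate (v : 'cV[R]_n) (f : 'cV[R]_n -> R) :
  mu.-integrable setT (EFin \o f) ->
  mu.-integrable setT (fun x => (f (x + v))%:E).
Proof.
have t1 := scalar_mx_is_trig n (1 : R).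
have d1 (i : 'I_n) : 0 < (1%:M : 'M[R]_n) i i by rewrite mxE eqxx.
move=> If; have := integrable_affine_cV v t1 d1 If.
by apply: eq_integrable => // x _; rewrite mul1mx addrC.
Qed.

Lemma integral_translate (v : 'cV[R]_n) (f : 'cV[R]_n -> R) :
  mu.-integrable setT (EFin \o f) ->
  (\int[mu]_x (f (x + v)%R)%:E = \int[mu]_x (f x)%:E)%E.
Proof.
have t1 := scalar_mx_is_trig n (1 : R).
have d1 (i : 'I_n) : 0 < (1%:M : 'M[R]_n) i i by rewrite mxE eqxx.
move=> If; rewrite (integral_affine_cV v t1 d1 If).
rewrite prod_diag_scalar_mx mul1e.
by apply: eq_integral => x _; rewrite mul1mx addrC.
Qed.

(* Integrate [w (z + v) - w z], whose integral is [0] by translation invariance,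
   as the integral over [s] in [[0, 1]] of [w' (z + s v)], whose integral in [z]
   does not depend on [s]. *)
Lemma integral_directional_derivative (v : 'cV[R]_n) (w w' : 'cV[R]_n -> R) :
  mu.-integrable setT (EFin \o w) -> mu.-integrable setT (EFin \o w') ->
  (forall z (s : R), is_derive s (1 : R) (fun s : R => w (z + s *: v)) (w' (z + s *: v))) ->
  (forall z, continuous (fun s : R => w' (z + s *: v))) ->
  (\int[mu]_x (w' x)%:E = 0)%E.
Proof.
move=> Iw Iw' dw cw'.
pose H (p : R * 'cV[R]_n) := (\1_`[0%R, 1%R] p.1 * w' (p.2 + p.1 *: v))%:E.
have mw' : measurable_fun [set: 'cV[R]_n] w'.
  by apply/measurable_EFinP; exact: measurable_int Iw'.
have mH : measurable_fun [set: R * 'cV[R]_n] H.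
  apply/measurable_EFinP; apply: measurable_funM.
    by apply: measurableT_comp.
  apply: measurableT_comp => //; apply: measurable_fun_cVP => i.
  under eq_fun do rewrite !mxE.
  apply: measurable_funD.
    exact: (measurableT_comp (measurable_coord i) measurable_snd).
  by apply: measurable_funM.
(* Translation invariance makes this the same for all [s] in [0, 1], so [H] is integrable on the
   product and Fubini applies. *)
have Iabs s : (\int[mu]_z `|H (s, z)| =
    (\1_`[0%R, 1%R] s)%:E * \int[mu]_z `|(w' z)%:E|)%E.
  rewrite -(@integral_translate (s *: v) (fun z => `|w' z|)); last first.
    exact: (integrable_norm Iw').
  rewrite -ge0_integralZl //.
  - apply: eq_integral => z _; rewrite /H /= normrM EFinM.
    by rewrite (@ger0_norm _ (\1_ _ _)).
  - apply/measurable_EFinP/measurableT_comp => //; apply: measurableT_comp => //.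
    apply: measurable_fun_cVP => i; under eq_fun do rewrite !mxE.
    by apply: measurable_funD => //; exact: measurable_coord.
have IH : (@lebesgue_measure R \x mu)%E.-integrable setT H.
  apply/integrable12ltyP => //; under eq_integral do rewrite Iabs.
  rewrite ge0_integralZr //; last 2 first.
  - exact/measurable_EFinP.
  - by apply: integral_ge0.
  rewrite integral_indic // setIT /= lebesgue_measure_itv /= lte_fin ltr01.
  by rewrite sube0 mul1e; case/integrableP : Iw'.
have I1 s : (\int[mu]_z H (s, z) =
    (\1_`[0%R, 1%R] s)%:E * \int[mu]_z (w' z)%:E)%E.
  rewrite -(integral_translate (s *: v) Iw') -integralZl //; last first.
    exact: integrable_translate.
have I2 z : (\int[lebesgue_measure]_s H (s, z) = (w (z + v) - w z)%:E)%E.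
  transitivity (\int[lebesgue_measure]_(s in `[0%R, 1%R]) (w' (z + s *: v))%:E)%E.
    rewrite [RHS]integral_mkcond; apply: eq_integral => s _.
    by rewrite /H epatch_indic /= muleC EFinM.
  have dwz := dw z.
  have cw : continuous (fun s : R => w (z + s *: v)).
    move=> s; apply/differentiable_continuous/derivable1_diffP.
    exact: (@ex_derive _ _ _ _ _ _ _ (dwz s)).
  rewrite (@continuous_FTC2 _ _ (fun s : R => w (z + s *: v))) //.
  - by rewrite scale1r scale0r addr0.
  - exact: continuous_subspaceT.
  - split.
    + by move=> s _; exact: (@ex_derive _ _ _ _ _ _ _ (dwz s)).
    + exact/cvg_at_right_filter/cw.
    + exact/cvg_at_left_filter/cw.
  - by move=> s _; rewrite derive1E (@derive_val _ _ _ _ _ _ _ (dwz s)).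
have := Fubini IH.
under eq_integral do rewrite I1.
under [X in _ = X -> _]eq_integral do rewrite I2 EFinB.
rewrite integralB //; last exact: integrable_translate.
rewrite integral_translate // subee; last exact: integrable_fin_num.
rewrite -(fineK (integrable_fin_num measurableT Iw')) integralZr //; last first.
  exact: integrable_indic_itv.
by rewrite integral_indic // setIT /= lebesgue_measure_itv /= lte_fin ltr01
  sube0 mul1e.
Qed.

End divergence.

(** * The standard Gaussian, reparametrization and Stein's identity *)

Section standard_gaussian.
Variables (R : realType) (n : nat).
Local Notation mu := (lebesgue_cV R n).
Implicit Types (z : 'cV[R]_n) (f g : 'cV[R]_n -> R).

(** The product form lets normalization follow by induction through [cV_cons]; [stdgE] gives the
    exponential form. *)
Definition stdg z : R := \prod_i normal_pdf 0 1 (z i 0).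

Lemma stdgE z : stdg z =
  (Num.sqrt ((2 * pi) ^+ n))^-1 * expR (- (\sum_i z i 0 ^+ 2) / 2).
Proof.
rewrite /stdg; under eq_bigr do
  rewrite normal_pdfE ?oner_neq0// /normal_peak /normal_fun expr1n subr0 mul1r.
rewrite big_split /= -expR_sum -mulr_suml sumrN; congr (_ * _).
rewrite big_const_ord iter_mulr_1 exprVn -mulr_natl; congr (_^-1).
elim: n => [|k IHk]; first by rewrite !expr0 sqrtr1.
by rewrite exprS IHk -sqrtrM ?exprS// mulr_ge0 ?pi_ge0.
Qed.

Lemma stdg_gt0 z : 0 < stdg z.
Proof.
by rewrite stdgE mulr_gt0 ?expR_gt0// invr_gt0 sqrtr_gt0 exprn_gt0// mulr_gt0 ?pi_gt0.
Qed.

Lemma measurable_stdg : measurable_fun [set: 'cV[R]_n] stdg.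
Proof.
apply: measurable_prod => i _.
exact: (measurableT_comp (measurable_normal_pdf 0 1) (measurable_coord i)).
Qed.

Lemma is_derive_stdg (j : 'I_n) z (s : R) :
  is_derive s (1 : R) (fun s : R => stdg (z + s *: delta_mx j 0))
    (- (z + s *: delta_mx j 0) j 0 * stdg (z + s *: delta_mx j 0)).
Proof.
pose a := \sum_i z i 0 ^+ 2.
(* Along a coordinate line the exponent is a quadratic polynomial in [t]. *)
have e (t : R) : stdg (z + t *: delta_mx j 0) =
    (Num.sqrt ((2 * pi) ^+ n))^-1 * expR (- (a + 2 * t * z j 0 + t ^+ 2) / 2).
  rewrite stdgE; congr (_ * expR (- _ / 2)).
  rewrite /a (bigD1 j) //= [in RHS](bigD1 j) //= !mxE !eqxx /= mulr1.
  rewrite (eq_bigr (fun i => z i 0 ^+ 2)); first by ring.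
  by move=> i ij; rewrite !mxE (negbTE ij) mulr0 addr0.
rewrite (_ : (fun s : R => _) = fun t =>
    (Num.sqrt ((2 * pi) ^+ n))^-1 * expR (- (a + 2 * t * z j 0 + t ^+ 2) / 2));
  last exact/funext.
rewrite e; apply: is_derive_eq.
rewrite !mxE !eqxx /= mulr1 /GRing.scale /=.
move: (expR _) (Num.sqrt _)^-1 => E K.
rewrite !mulr0 !add0r !mulr1 mul1r.
by field.
Qed.

End standard_gaussian.

Section gaussian_density.
Variables (R : realType) (n : nat).
Implicit Types (m z : 'cV[R]_n) (C : 'M[R]_n).

(** As the diagonal of [C] is positive, the square root of det (C C^T) is the Jacobian
    [\prod_i C i i], and the quadratic form at [m + C *m z] collapses to |z|^2. *)
Lemma gauss_affine m C z : Omega (m, C) ->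
  gauss (m, C) (m + C *m z) * \prod_i C i i = stdg z.
Proof.
move=> [/= tC C0].
have P0 : 0 < \prod_i C i i by apply: prodr_gt0 => i _.
have dC : \det C = \prod_i C i i by rewrite det_trig.
have uC : C \in unitmx by rewrite unitmxE dC unitfE gt_eqF.
rewrite /gauss /gauss_pdf /= stdgE.
rewrite det_mulmx det_tr dC addrC addKr.
rewrite trmx_mul !mulmxA.
have uCT : C^T \in unitmx by rewrite unitmx_tr.
have uV : C *m C^T \in unitmx by rewrite unitmx_mul uC.
have -> : invmx (C *m C^T) = invmx C^T *m invmx C.
  apply: (can_inj (mulKmx uV)).
  by rewrite mulmxV // mulmxA mulmxK // mulmxV.
rewrite !mulmxA mulmxK // mulmxKV //.
rewrite sqrtrM ?exprn_ge0 ?mulr_ge0 ?pi_ge0// -expr2 sqrtr_sqr gtr0_norm//.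
rewrite mulrAC invfM divfK ?gt_eqF//.
congr (_ * expR (- _ / 2)).
by rewrite mxE; apply: eq_bigr => i _; rewrite mxE.
Qed.

(** Reparametrization moves the parameters from the density to the integrand, where convexity of
    [lbar] applies pointwise under one fixed measure. *)
Lemma has_expectation_affine m C (f : 'cV[R]_n -> R) : Omega (m, C) ->
  has_expectation (gauss (m, C)) f ->
  has_expectation (@stdg R n) (fun z => f (m + C *m z)).
Proof.
move=> O If; have [/= tC C0] := O.
have := integrableZl measurableT (\prod_i C i i) (integrable_affine_cV m tC C0 If).
apply: eq_integrable => // z _ /=.
by rewrite -EFinM mulrA (mulrC (\prod_i _)) gauss_affine.
Qed.

Lemma expectation_affine m C (f : 'cV[R]_n -> R) : Omega (m, C) ->
  has_expectation (gauss (m, C)) f ->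
  expectation (gauss (m, C)) f = expectation (@stdg R n) (fun z => f (m + C *m z)).
Proof.
move=> O If; have [/= tC C0] := O.
rewrite /expectation /Rintegral (integral_affine_cV m tC C0 If).
rewrite -integralZl//; last exact: (integrable_affine_cV m tC C0 If).
congr fine; apply: eq_integral => z _ /=.
by rewrite -EFinM mulrA (mulrC (\prod_i _)) gauss_affine.
Qed.

End gaussian_density.

Section expectation_theory.
Variables (R : realType) (n : nat).
Local Notation mu := (lebesgue_cV R n).
Implicit Types (q f g : 'cV[R]_n -> R).

Lemma has_expectationD q f g : has_expectation q f -> has_expectation q g ->
  has_expectation q (fun z => f z + g z).
Proof.
move=> If Ig; have := integrableD measurableT If Ig.
by apply: eq_integrable => // z _; rewrite /= -EFinD mulrDr.
Qed.

Lemma expectationD q f g : has_expectation q f -> has_expectation q g ->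
  expectation q (fun z => f z + g z) = expectation q f + expectation q g.
Proof.
move=> If Ig; rewrite /expectation -RintegralD //.
by apply: eq_Rintegral => z _; rewrite mulrDr.
Qed.

Lemma has_expectationZ q f (k : R) : has_expectation q f ->
  has_expectation q (fun z => k * f z).
Proof.
move=> If; have := integrableZl measurableT k If.
by apply: eq_integrable => // z _; rewrite -EFinM mulrCA.
Qed.

Lemma expectationZ q f (k : R) : has_expectation q f ->
  expectation q (fun z => k * f z) = k * expectation q f.
Proof.
move=> If; rewrite /expectation -RintegralZl //.
by apply: eq_Rintegral => z _; rewrite mulrCA.
Qed.

Lemma has_expectationB q f g : has_expectation q f -> has_expectation q g ->
  has_expectation q (fun z => f z - g z).
Proof.
move=> If Ig; have := has_expectationD If (has_expectationZ (-1) Ig).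
by apply: eq_integrable => // z _; rewrite mulN1r.
Qed.

Lemma expectationB q f g : has_expectation q f -> has_expectation q g ->
  expectation q (fun z => f z - g z) = expectation q f - expectation q g.
Proof.
move=> If Ig; rewrite -[X in _ - X]mul1r -mulNr -expectationZ//.
rewrite -expectationD //; last exact: has_expectationZ.
by apply: eq_Rintegral => z _; rewrite mulN1r.
Qed.

Lemma has_expectation_sum q (I : finType) (P : pred I) (F : I -> 'cV[R]_n -> R) :
  (forall i, P i -> has_expectation q (F i)) ->
  has_expectation q (fun z => \sum_(i | P i) F i z).
Proof.
move=> IF; have : mu.-integrable setT
    (fun z => \sum_(i | P i) (fun i z => (q z * F i z)%:E) i z)%E.
  by apply: integrable_sum => // i Pi; exact: IF.
by apply: eq_integrable => // z _; rewrite sumEFin mulr_sumr.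
Qed.

Lemma expectation_sum q (I : finType) (P : pred I) (F : I -> 'cV[R]_n -> R) :
  (forall i, has_expectation q (F i)) ->
  expectation q (fun z => \sum_(i | P i) F i z) =
  \sum_(i | P i) expectation q (F i).
Proof.
move=> IF; rewrite unlock /reducebig.
elim: (index_enum I) => /= [|i s IHs].
  rewrite /expectation; under eq_Rintegral do rewrite mulr0.
  by rewrite Rintegral_cst // mul0r.
case: ifP => // Pi; rewrite expectationD // ?IHs //.
have : has_expectation q (fun z => \sum_(j <- s | P j) F j z).
  have : mu.-integrable setT
      (fun z => \sum_(i <- s | P i) (fun i z => (q z * F i z)%:E) i z)%E.
    by apply: integrable_sum => // j Pj; exact: IF.
  by apply: eq_integrable => // z _; rewrite sumEFin mulr_sumr.
by rewrite unlock.
Qed.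

Lemma le_expectation q f g : (forall z, 0 <= q z) ->
  has_expectation q f -> has_expectation q g ->
  (forall z, f z <= g z) -> expectation q f <= expectation q g.
Proof.
by move=> q0 If Ig fg; apply: le_Rintegral => // z _; rewrite ler_wpM2l.
Qed.

Lemma le_has_expectation q f g : (forall z, 0 <= q z) ->
  measurable_fun [set: 'cV[R]_n] (fun z => q z * f z) ->
  has_expectation q g -> (forall z, `|f z| <= g z) -> has_expectation q f.
Proof.
move=> q0 mf Ig fg; apply: (le_integrable measurableT _ _ Ig).
  exact/measurable_EFinP.
move=> z _; rewrite !abse_EFin lee_fin !normrM ler_wpM2l//.
by rewrite (le_trans (fg z))// ler_norm.
Qed.

End expectation_theory.

Section stein.
Variable R : realType.

Lemma integral_stdg n : (\int[lebesgue_cV R n]_z (stdg z)%:E = 1)%E.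
Proof.
elim: n => [|n IHn].
  under eq_integral do rewrite /stdg big_ord0.
  by rewrite integral_cst //= diracT mule1.
rewrite ge0_integral_cV_cons; last 2 first.
- by apply/measurable_EFinP; exact: measurable_stdg.
- by move=> z; rewrite lee_fin ltW ?stdg_gt0.
rewrite -[RHS](@integral_normal_pdf R 0 1); apply: eq_integral => x _.
transitivity (\int[lebesgue_cV R n]_y ((normal_pdf 0 1 x)%:E * (stdg y)%:E))%E.
  apply: eq_integral => y _; rewrite -EFinM /stdg big_ord_recl cV_cons0.
  by congr (_ * _)%:E; apply: eq_bigr => i _; rewrite cV_consS.
rewrite ge0_integralZl_EFin ?IHn ?mule1 ?normal_pdf_ge0 //.
- by move=> y _; rewrite lee_fin ltW ?stdg_gt0.
- by apply/measurable_EFinP; exact: measurable_stdg.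
Qed.

Variable n : nat.
Local Notation mu := (lebesgue_cV R n).
Implicit Types (z : 'cV[R]_n) (u : 'cV[R]_n -> R).

Lemma has_expectation_stdg_cst (c : R) : has_expectation (@stdg R n) (fun=> c).
Proof.
have I1 : mu.-integrable setT (fun z => (stdg z)%:E).
  apply/integrableP; split; first by apply/measurable_EFinP; exact: measurable_stdg.
  under eq_integral do rewrite abse_EFin gtr0_norm ?stdg_gt0//.
  by rewrite integral_stdg ltry.
have := integrableZl measurableT c I1.
by apply: eq_integrable => // z _; rewrite -EFinM mulrC.
Qed.

Lemma expectation_stdg_cst (c : R) : expectation (@stdg R n) (fun=> c) = c.
Proof.
have := expectationZ c (has_expectation_stdg_cst 1); rewrite mulr1 => ->.
rewrite /Defs.expectation /Rintegral; under eq_integral do rewrite mulr1.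
by rewrite integral_stdg mulr1.
Qed.

(** The derivative of [stdg * u] along the [j]-th axis is [stdg z * (u' z - z j 0 * u z)]; its
    integral vanishes by translation invariance, so no boundary term has to be estimated. *)
Lemma stein (j : 'I_n) u u' :
  has_expectation (@stdg R n) u -> has_expectation (@stdg R n) u' ->
  has_expectation (@stdg R n) (fun z => z j 0 * u z) ->
  (forall z (s : R), is_derive s (1 : R) (fun s : R => u (z + s *: delta_mx j 0))
    (u' (z + s *: delta_mx j 0))) ->
  (forall z, continuous (fun s : R => u' (z + s *: delta_mx j 0))) ->
  expectation (@stdg R n) (fun z => z j 0 * u z) = expectation (@stdg R n) u'.
Proof.
move=> Iu Iu' Izu du cu'.
have Iw' := has_expectationB Iu' Izu.
have dcont (f df : R -> R) : (forall s, is_derive s (1 : R) f (df s)) -> continuous f.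
  move=> d s; apply/differentiable_continuous/derivable1_diffP.
  exact: (@ex_derive _ _ _ _ _ _ _ (d s)).
suff : expectation (@stdg R n) (fun z => u' z - z j 0 * u z) = 0.
  by rewrite expectationB // => /eqP; rewrite subr_eq0 => /eqP ->.
rewrite /Defs.expectation /Rintegral.
pose w z := stdg z * u z; pose w' z := stdg z * (u' z - z j 0 * u z).
have dw z (s : R) : is_derive s (1 : R) (fun s : R => w (z + s *: delta_mx j 0))
    (w' (z + s *: delta_mx j 0)).
  have d1 := is_derive_stdg j z s; have d2 := du z s.
  rewrite /w /w'; apply: is_derive_eq; rewrite /GRing.scale /=; ring.
rewrite (integral_directional_derivative Iu Iw' dw) // => z.
have c1 := dcont _ _ (is_derive_stdg j z); have c2 := dcont _ _ (du z).
move=> s; apply: cvgM; first exact: c1.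
apply: cvgB; first exact: cu'.
apply: cvgM; last exact: c2.
under eq_cvg do rewrite !mxE; rewrite !mxE.
by apply: cvgD; [exact: cvg_cst|apply: cvgM; [exact: cvg_id|exact: cvg_cst]].
Qed.

End stein.

(** * Strong convexity and free energy *)

Section strong_convexity.
Variables (R : realType) (d : nat).
Implicit Types (x v : 'cV[R]_d) (f : 'cV[R]_d -> R).

Definition dotv x v : R := \sum_i x i 0 * v i 0.

Lemma dotvE x v : dotv x v = (x^T *m v) 0 0.
Proof. by rewrite mxE; apply: eq_bigr => i _; rewrite mxE. Qed.

Lemma is_derive_line f x v (s : R) : (forall y, differentiable f y) ->
  is_derive s (1 : R) (fun s : R => f (x + s *: v))
    (\sum_i 'D_(delta_mx i 0) f (x + s *: v) * v i 0).
Proof.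
move=> df; set y := x + s *: v.
have -> : \sum_i 'D_(delta_mx i 0) f y * v i 0 = 'D_v f y.
  rewrite deriveE // [in RHS](matrix_sum_delta v) linear_sum; apply: eq_bigr => i _.
  by rewrite big_ord1 linearZ /= -deriveE // mulrC.
have dv : derivable f y v by exact: diff_derivable.
pose F (t : R) := f (x + t *: v).
have E : (fun h : R => h^-1 *: (F (h *: (1 : R) + s) - F s)) =
    (fun h : R => h^-1 *: (f (h *: v + y) - f y)).
  apply/funext => h; rewrite /F /y; congr (_ *: (f _ - _)).
  by rewrite scalerDl addrCA /GRing.scale /= mulr1.
have dF : derivable F s (1 : R) by move: dv; rewrite /derivable /= -E.
by apply: DeriveDef => //; rewrite /derive /= E.
Qed.

Variable lbar : 'cV[R]_d -> R.
Hypothesis lbar_C2 : twice_continuously_differentiable lbar.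

Lemma is_derive_lbar x v (s : R) :
  is_derive s (1 : R) (fun s : R => lbar (x + s *: v))
    (dotv (grad lbar (x + s *: v)) v).
Proof.
have [d1 _ _] := lbar_C2.
apply: is_derive_eq; first exact: is_derive_line.
by apply: eq_bigr => i _; rewrite mxE.
Qed.

Lemma is_derive_grad i x v (s : R) :
  is_derive s (1 : R) (fun s : R => grad lbar (x + s *: v) i 0)
    (\sum_j hess lbar (x + s *: v) i j * v j 0).
Proof.
have [_ d2 _] := lbar_C2.
apply: is_derive_eq; first apply: (@is_derive_line (fun y => grad lbar y i 0)).
  move=> y; apply: (@differentiable_comp _ _ _ _ (grad lbar) (fun M : 'cV[R]_d => M i 0)) => //.
  exact: differentiable_coord.
by apply: eq_bigr => j _; rewrite [X in _ = X * _]mxE.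
Qed.

Variable delta : R.
Hypothesis convex : forall x, loewner_ge (hess lbar x) (delta%:M).

Lemma le_hess x v :
  delta * dotv v v <= \sum_i (\sum_j hess lbar x i j * v j 0) * v i 0.
Proof.
have [_ /(_ v)] := convex x.
rewrite mulmxBr mulmxBl [X in 0 <= X]mxE [X in 0 <= _ + X]mxE subr_ge0.
rewrite mul_mx_scalar -scalemxAl mxE -dotvE => /le_trans; apply.
rewrite -mulmxA mxE le_eqVlt; apply/orP; left; apply/eqP.
by apply: eq_bigr => i _; rewrite !mxE mulrC.
Qed.

(** The mean value theorem is used twice along the line through [x]: on the slope [g'], then on
    [lbar] minus its quadratic minorant, whose slope is nonnegative by the first use. *)
Lemma strongly_convex_le x v :
  lbar x + dotv (grad lbar x) v + delta / 2 * dotv v v <= lbar (x + v).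
Proof.
pose g' (s : R) := dotv (grad lbar (x + s *: v)) v.
pose g'' (s : R) := \sum_i (\sum_j hess lbar (x + s *: v) i j * v j 0) * v i 0.
have cont (f df : R -> R) : (forall s, is_derive s (1 : R) f (df s)) -> continuous f.
  move=> dff s; apply/differentiable_continuous/derivable1_diffP.
  exact: (@ex_derive _ _ _ _ _ _ _ (dff s)).
have dg' s : is_derive s (1 : R) g' (g'' s).
  have -> : g' = \sum_i (fun s : R => v i 0 * grad lbar (x + s *: v) i 0).
    by apply/funext => t; rewrite fct_sumE; apply: eq_bigr => i _; rewrite mulrC.
  have dg i := is_derive_grad i x v s.
  apply: is_derive_eq; apply: eq_bigr => i _.
  by rewrite /GRing.scale /= mulrC.
have g'_ge s : 0 < s -> g' 0 + delta * s * dotv v v <= g' s.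
  move=> s0.
  have [c _ ec] := MVT s0 (fun c _ => dg' c) (continuous_subspaceT (cont _ _ dg')).
  have := le_hess (x + c *: v) v; rewrite -/(g'' c) => h.
  rewrite subr0 in ec; rewrite addrC -lerBrDr ec mulrAC.
  by rewrite ler_wpM2r // ltW.
pose h (s : R) := lbar (x + s *: v) - (s * g' 0 + delta / 2 * dotv v v * s ^+ 2).
have dh s : is_derive s (1 : R) h (g' s - (g' 0 + delta * s * dotv v v)).
  have d1 : is_derive s (1 : R) (fun s : R => lbar (x + s *: v)) (g' s).
    exact: is_derive_lbar.
  by apply: is_derive_eq; rewrite /GRing.scale /=; field.
have [c c01 ec] := MVT ltr01 (fun c _ => dh c) (continuous_subspaceT (cont _ _ dh)).
have := g'_ge c; move: c01; rewrite in_itv /= => /andP[c0 _] /(_ c0).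
rewrite -subr_ge0 => hc.
have : 0 <= h 1 - h 0 by rewrite ec subr0 mulr1.
rewrite /h /g' scale1r scale0r addr0 expr0n expr1n /=; lra.
Qed.

End strong_convexity.

(** * Gaussian moments of order at most two *)

Section moments.
Variables (R : realType) (n : nat).
Local Notation mu := (lebesgue_cV R n).
Implicit Types (z : 'cV[R]_n).

(** Domination by [4 * stdg (z / 2)], integrable by the change of variables with matrix I / 2: z_j^2
    <= 4 exp (z_j^2 / 4), and the wider Gaussian absorbs the exponential. *)
Lemma has_expectation_stdg_sqr (j : 'I_n) :
  has_expectation (@stdg R n) (fun z => z j 0 ^+ 2).
Proof.
have t1 : is_trig_mx ((2^-1)%:M : 'M[R]_n) := scalar_mx_is_trig n _.
have d1 (i : 'I_n) : 0 < ((2^-1)%:M : 'M[R]_n) i i by rewrite mxE eqxx mulr1n.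
have := has_expectation_stdg_cst n (1 : R).
move=> /(integrable_affine_cV 0 t1 d1) /(integrableZl measurableT 4) I4.
apply: (le_integrable measurableT _ _ I4).
  apply/measurable_EFinP/measurable_funM; first exact: measurable_stdg.
  by apply: measurable_funX; exact: measurable_coord.
move=> z _; rewrite add0r mul_scalar_mx mulr1 -EFinM !abse_EFin lee_fin.
rewrite ger0_norm; last by rewrite mulr_ge0 ?sqr_ge0 // ltW ?stdg_gt0.
rewrite ger0_norm; last by rewrite mulr_ge0 // ltW ?stdg_gt0.
rewrite !stdgE -mulrA [leRHS]mulrCA ler_wpM2l ?invr_ge0 ?sqrtr_ge0 //.
have -> : \sum_i (2^-1 *: z) i 0 ^+ 2 = (\sum_i z i 0 ^+ 2) / 4.
  by rewrite mulr_suml; apply: eq_bigr => i _; rewrite mxE; field.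
set a := \sum_i z i 0 ^+ 2; set b := z j 0 ^+ 2.
have ba : b <= a.
  by rewrite /a (bigD1 j) //= lerDl sumr_ge0 // => i _; exact: sqr_ge0.
have b0 : 0 <= b by exact: sqr_ge0.
have : 1 + b / 4 <= expR (b / 4) by exact: expR_ge1Dx.
have : expR (b / 4) * expR (- a / 2) <= expR (- (a / 4) / 2).
  by rewrite -expRD ler_expR; lra.
have := expR_ge0 (- a / 2); set E := expR (- a / 2) => E0 h1 h2.
apply: le_trans (_ : (4 * expR (b / 4)) * E <= _); last by rewrite -mulrA ler_pM2l.
by rewrite mulrC ler_wpM2r //; lra.
Qed.

Lemma has_expectation_stdg_mul (i j : 'I_n) :
  has_expectation (@stdg R n) (fun z => z i 0 * z j 0).
Proof.
apply: (@le_has_expectation _ _ _ _ (fun z => z i 0 ^+ 2 + z j 0 ^+ 2)).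
- by move=> z; exact/ltW/stdg_gt0.
- apply: measurable_funM; first exact: measurable_stdg.
  by apply: measurable_funM; exact: measurable_coord.
- by apply: has_expectationD; exact: has_expectation_stdg_sqr.
- move=> z; rewrite ler_norml; nra.
Qed.

Lemma has_expectation_stdg_coord (i : 'I_n) :
  has_expectation (@stdg R n) (fun z => z i 0).
Proof.
apply: (@le_has_expectation _ _ _ _ (fun z => 1 + z i 0 ^+ 2)).
- by move=> z; exact/ltW/stdg_gt0.
- by apply: measurable_funM; [exact: measurable_stdg|exact: measurable_coord].
- apply: has_expectationD; first exact: has_expectation_stdg_cst.
  exact: has_expectation_stdg_sqr.
- move=> z; rewrite ler_norml; nra.
Qed.

(** Both moments come from Stein's identity, with [u = 1] here and [u = z_j] below, so no Gaussian
    integral is computed. *)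
Lemma expectation_stdg_coord (i : 'I_n) :
  expectation (@stdg R n) (fun z => z i 0) = 0.
Proof.
have h := @stein R n i (fun=> 1) (fun=> 0).
rewrite -[RHS](expectation_stdg_cst n (0 : R)) -h.
- by apply: eq_Rintegral => z _; rewrite mulr1.
- exact: has_expectation_stdg_cst.
- exact: has_expectation_stdg_cst.
- have := has_expectation_stdg_coord i.
  by apply: eq_integrable => // z _; rewrite mulr1.
- by move=> z; exact: cst_continuous.
Qed.

Lemma expectation_stdg_mul (i j : 'I_n) :
  expectation (@stdg R n) (fun z => z i 0 * z j 0) = (i == j)%:R.
Proof.
have dz z (s : R) : is_derive s (1 : R)
    (fun s : R => (z + s *: delta_mx i 0) j 0) ((i == j)%:R : R).
  rewrite (_ : (fun _ : R => _) = fun s : R => z j 0 + s * (i == j)%:R); last first.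
    by apply/funext => t; rewrite !mxE eqxx andbT eq_sym.
  by apply: is_derive_eq; rewrite /GRing.scale /= mulr0 !add0r mul1r mulr1.
rewrite -[RHS](expectation_stdg_cst n).
rewrite -(stein (has_expectation_stdg_coord j)
  (has_expectation_stdg_cst n ((i == j)%:R : R)) (has_expectation_stdg_mul i j) dz) //.
by move=> z; exact: cst_continuous.
Qed.

(** Summed over the rows, this turns delta / 2 |n + W z|^2 into delta / 2 (|n|^2 + |W|_F^2): strong
    convexity of [lbar] passes to (m, C) with the same modulus. *)
Lemma expectation_stdg_affine_sqr (c : R) (w : 'I_n -> R) :
  has_expectation (@stdg R n) (fun z => (c + \sum_j w j * z j 0) ^+ 2) /\
  expectation (@stdg R n) (fun z => (c + \sum_j w j * z j 0) ^+ 2) =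
    c ^+ 2 + \sum_j w j ^+ 2.
Proof.
have -> : (fun z => (c + \sum_j w j * z j 0) ^+ 2) = fun z : 'cV[R]_n =>
    c ^+ 2 + (\sum_j (2 * c * w j) * z j 0
    + \sum_i (\sum_j (w i * w j) * (z i 0 * z j 0))).
  apply/funext => z; rewrite sqrrD -mulr_natl addrA; congr (_ + _ + _).
    by rewrite mulrA mulr_sumr; apply: eq_bigr => j _; rewrite mulrA.
  rewrite expr2 mulr_suml; apply: eq_bigr => i _.
  by rewrite mulr_sumr; apply: eq_bigr => j _; ring.
have I1 j : has_expectation (@stdg R n) (fun z => (2 * c * w j) * z j 0).
  by apply: has_expectationZ; exact: has_expectation_stdg_coord.
have I2 i j : has_expectation (@stdg R n) (fun z => (w i * w j) * (z i 0 * z j 0)).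
  by apply: has_expectationZ; exact: has_expectation_stdg_mul.
have I3 i : has_expectation (@stdg R n)
    (fun z => \sum_j (w i * w j) * (z i 0 * z j 0)).
  by apply: has_expectation_sum => j _; exact: I2.
have I4 := has_expectation_sum (fun i (_ : xpredT i) => I3 i).
have I5 := has_expectation_sum (fun i (_ : xpredT i) => I1 i).
have I6 := has_expectationD I5 I4.
have I7 := has_expectation_stdg_cst n (c ^+ 2).
split; first exact: (has_expectationD I7 I6).
rewrite (expectationD I7 I6) expectation_stdg_cst (expectationD I5 I4).
rewrite !expectation_sum // big1 => [|j _]; last first.
  rewrite expectationZ ?expectation_stdg_coord ?mulr0 //.
  exact: has_expectation_stdg_coord.
rewrite add0r; congr (_ + _); apply: eq_bigr => i _.
rewrite expectation_sum // (bigD1 i) //= big1 ?addr0 => [|j ji]; last first.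
  rewrite expectationZ ?expectation_stdg_mul; last exact: has_expectation_stdg_mul.
  by rewrite eq_sym (negbTE ji) mulr0.
rewrite expectationZ ?expectation_stdg_mul; last exact: has_expectation_stdg_mul.
by rewrite eqxx mulr1.
Qed.

End moments.

(** * The free energy and its convexity in (m, C) *)

Section kullback_leibler.
Variables (R : realType) (d : nat) (lbar : 'cV[R]_d -> R).
Let Z := \int[lebesgue_cV R d]_y expR (- lbar y).
Hypothesis Z_gt0 : 0 < Z.
Hypothesis KL_fin : forall tau, Omega tau ->
  KL_finite (gauss tau) (posterior lbar).

Definition free_energy (tau : 'cV[R]_d * 'M[R]_d) : R :=
  fine (KL (gauss tau) (posterior lbar)).

Lemma free_energyE tau : Omega tau ->
  KL (gauss tau) (posterior lbar) = (free_energy tau)%:E.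
Proof. by move=> /KL_fin h; rewrite fineK //; exact: integrable_fin_num. Qed.

Lemma ln_gauss_posterior tau z : Omega tau ->
  ln (gauss tau (tau.1 + tau.2 *m z) / posterior lbar (tau.1 + tau.2 *m z)) =
  ln (stdg z) + ln Z - ln (\prod_i tau.2 i i) + lbar (tau.1 + tau.2 *m z).
Proof.
case: tau => m C O; have [/= tC C0] := O.
have P0 : 0 < \prod_i C i i by apply: prodr_gt0 => i _.
have -> : gauss (m, C) (m + C *m z) = stdg z / \prod_i C i i.
  by rewrite -(gauss_affine z O) mulfK // gt_eqF.
rewrite /posterior -/Z invfM invrK -expRN opprK.
rewrite !lnM ?posrE ?mulr_gt0 ?invr_gt0 ?stdg_gt0 ?expR_gt0 //.
by rewrite lnV ?posrE // expRK; ring.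
Qed.

Lemma free_energyB tau tau' : Omega tau -> Omega tau' ->
  has_expectation (@stdg R d) (fun z =>
    lbar (tau'.1 + tau'.2 *m z) - lbar (tau.1 + tau.2 *m z)) /\
  free_energy tau' - free_energy tau =
  expectation (@stdg R d) (fun z =>
    lbar (tau'.1 + tau'.2 *m z) - lbar (tau.1 + tau.2 *m z))
  - (ln (\prod_i tau'.2 i i) - ln (\prod_i tau.2 i i)).
Proof.
move=> O O'.
have Q sg : Omega sg ->
    has_expectation (@stdg R d) (fun z => ln (stdg z) + ln Z
      - ln (\prod_i sg.2 i i) + lbar (sg.1 + sg.2 *m z)) /\
    free_energy sg = expectation (@stdg R d) (fun z => ln (stdg z) + ln Z
      - ln (\prod_i sg.2 i i) + lbar (sg.1 + sg.2 *m z)).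
  move=> Os; have KF := KL_fin Os; split.
    have := has_expectation_affine (m := sg.1) (C := sg.2).
    rewrite -surjective_pairing => /(_ _ Os KF).
    by apply: eq_integrable => // z _; rewrite ln_gauss_posterior.
  have := expectation_affine (m := sg.1) (C := sg.2).
  rewrite -surjective_pairing => /(_ _ Os KF) e.
  transitivity (expectation (gauss sg) (fun x => ln (gauss sg x / posterior lbar x))).
    rewrite /free_energy /KL /Defs.expectation /Rintegral; reflexivity.
  by rewrite e; apply: eq_Rintegral => z _; rewrite ln_gauss_posterior.
have [I E] := Q _ O; have [I' E'] := Q _ O'.
set c := ln (\prod_i tau'.2 i i) - ln (\prod_i tau.2 i i).
have IB := has_expectationB I' I.
have Ic := has_expectation_stdg_cst d c.
have := has_expectationD IB Ic; have := expectationD IB Ic.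
rewrite expectationB // expectation_stdg_cst -E -E' => eB IBc.
have ef : (fun z => ln (stdg z) + ln Z - ln (\prod_i tau'.2 i i)
      + lbar (tau'.1 + tau'.2 *m z)
      - (ln (stdg z) + ln Z - ln (\prod_i tau.2 i i) + lbar (tau.1 + tau.2 *m z))
      + c) =
    (fun z => lbar (tau'.1 + tau'.2 *m z) - lbar (tau.1 + tau.2 *m z)).
  by apply/funext => z; rewrite /c; ring.
by rewrite ef in IBc eB; split => //; rewrite eB addrK.
Qed.

End kullback_leibler.

Section free_energy_convexity.
Variables (R : realType) (d : nat) (lbar : 'cV[R]_d -> R) (delta : R).
Hypothesis lbar_C2 : twice_continuously_differentiable lbar.
Hypothesis delta_gt0 : 0 < delta.
Hypothesis convex : forall x, loewner_ge (hess lbar x) (delta%:M).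
Hypothesis Z_gt0 : 0 < \int[lebesgue_cV R d]_y expR (- lbar y).
Hypothesis KL_fin : forall tau, Omega tau ->
  KL_finite (gauss tau) (posterior lbar).
Variables (m : 'cV[R]_d) (C : 'M[R]_d).
Hypothesis OmC : Omega (m, C).
Hypothesis grad_fin : forall i,
  has_expectation (gauss (m, C)) (fun x => grad lbar x i 0).
Hypothesis hess_fin : forall i j,
  has_expectation (gauss (m, C)) (fun x => hess lbar x i j).
Local Notation stdg := (@stdg R d).
Local Notation G k := (fun z => grad lbar (m + C *m z) k 0).
Local Notation H := (expected_hess lbar (m, C)).
Local Notation g := (expected_grad lbar (m, C)).

Lemma has_expectation_grad k : has_expectation stdg (G k).
Proof. exact: has_expectation_affine (grad_fin k). Qed.

Lemma dotv_ge0 (v : 'cV[R]_d) : 0 <= dotv v v.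
Proof. by apply: sumr_ge0 => i _; rewrite -expr2 sqr_ge0. Qed.

(* By convexity the directional derivative along [v = n + W z] lies between
   [lbar x - lbar (x - v)] and [lbar (x + v) - lbar x], which are integrable. *)
Lemma has_expectation_dotv_grad (n : 'cV[R]_d) (W : 'M[R]_d) :
  Omega (m + n, C + W) -> Omega (m - n, C - W) ->
  has_expectation stdg (fun z => dotv (grad lbar (m + C *m z)) (n + W *m z)).
Proof.
move=> Op Om.
have [Ip _] := free_energyB Z_gt0 KL_fin OmC Op.
have [Im _] := free_energyB Z_gt0 KL_fin OmC Om.
have normI f : has_expectation stdg f -> has_expectation stdg (fun z => `|f z|).
  move=> /(integrable_norm); apply: eq_integrable => // z _.
  by rewrite /= normrM gtr0_norm // stdg_gt0.
apply: le_has_expectation (has_expectationD (normI _ Ip) (normI _ Im)) _.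
- by move=> z; exact/ltW/stdg_gt0.
- rewrite (_ : (fun z => _) = fun z => \sum_i (stdg z * G i z) *
      (n i 0 + \sum_j W i j * z j 0)); last first.
    apply/funext => z; rewrite /dotv mulr_sumr; apply: eq_bigr => i _.
    by rewrite mulrA !mxE.
  apply: measurable_sum => i; apply: measurable_funM.
    by apply/measurable_EFinP; exact: measurable_int (has_expectation_grad i).
  apply: measurable_funD => //; apply: measurable_sum => j.
  by apply: measurable_funM => //; exact: measurable_coord.
- move=> z /=; set x := m + C *m z; set v := n + W *m z.
  have -> : m + n + (C + W) *m z = x + v by rewrite mulmxDl addrACA.
  have -> : m - n + (C - W) *m z = x - v by rewrite mulmxBl addrACA -opprD.
  have h1 := strongly_convex_le lbar_C2 convex x v.
  have h2 := strongly_convex_le lbar_C2 convex x (- v).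
  have q : 0 <= delta / 2 * dotv v v by rewrite mulr_ge0 ?dotv_ge0 // divr_ge0 // ltW.
  have e1 : dotv (grad lbar x) (- v) = - dotv (grad lbar x) v.
    by rewrite -sumrN; apply: eq_bigr => i _; rewrite !mxE mulrN.
  have e2 : dotv (- v) (- v) = dotv v v.
    by apply: eq_bigr => i _; rewrite !mxE mulrNN.
  rewrite e1 e2 in h2.
  have := ler_norm (lbar (x + v) - lbar x).
  have := ler_norm (lbar (x - v) - lbar x).
  have := normr_ge0 (lbar (x + v) - lbar x).
  have := normr_ge0 (lbar (x - v) - lbar x).
  by rewrite ler_norml; lra.
Qed.

Lemma Omega_delta (k j : 'I_d) (e : R) : (j <= k)%N -> `|e| < C k k ->
  Omega (m, C + e *: delta_mx k j).
Proof.
have [/= /is_trig_mxP tC C0] := OmC.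
move=> jk ek; split=> /= [|i].
  apply/is_trig_mxP => a b ab; rewrite !mxE tC // add0r.
  case: eqP => [ak|_]; last by rewrite mulr0.
  by case: eqP => [bj|_]; rewrite ?mulr0 //; move: ab; rewrite ak bj ltnNge jk.
rewrite !mxE; case: eqP => [ik|_] /=; last by rewrite mulr0 addr0.
case: eqP => _; last by rewrite mulr0 addr0.
by move: ek; rewrite ik mulr1 ltr_norml => /andP[]; lra.
Qed.

(** Take a direction with the single entry [e] at (k, j), so that [v] has the single coordinate
    [e * z j 0]. Half of [C k k] keeps both [C + W] and [C - W] in [Omega], and [j <= k] keeps them
    lower triangular. *)
Lemma has_expectation_coord_grad (k j : 'I_d) : (j <= k)%N ->
  has_expectation stdg (fun z => z j 0 * G k z).
Proof.
move=> jk; have [_ /= /(_ k) Ck] := OmC.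
pose e := C k k / 2.
have e0 : 0 < e by rewrite divr_gt0.
have ne : `|e| < C k k by rewrite gtr0_norm // /e; lra.
have Op := Omega_delta jk ne.
have Om : Omega (m, C - e *: delta_mx k j).
  by rewrite -scaleNr; apply: Omega_delta => //; rewrite normrN.
have := @has_expectation_dotv_grad 0 (e *: delta_mx k j).
rewrite addr0 subr0 => /(_ Op Om) /(has_expectationZ e^-1).
apply: eq_integrable => // z _; congr (_ * _)%:E.
have WE i : (e *: delta_mx k j *m z) i 0 = (i == k)%:R * (e * z j 0).
  rewrite mxE (bigD1 j) //= !mxE eqxx andbT mulrAC big1 ?addr0 1?mulrC// => l lj.
  by rewrite !mxE (negbTE lj) andbF mulr0 mul0r.
rewrite add0r /dotv (bigD1 k) //= big1 ?addr0 => [|i ik]; last first.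
  by rewrite WE (negbTE ik) mul0r mulr0.
by rewrite WE eqxx mul1r; field; rewrite gt_eqF.
Qed.

Lemma has_expectation_hess k l : has_expectation stdg
  (fun z => hess lbar (m + C *m z) k l).
Proof. exact: (has_expectation_affine OmC (hess_fin k l)). Qed.

(** Stein's identity for the k-th partial derivative of [lbar] at [m + C *m z]; the chain rule
    brings out column [j] of [C]. *)
Lemma expectation_coord_grad (k j : 'I_d) : (j <= k)%N ->
  expectation stdg (fun z => z j 0 * G k z) = (H *m C) k j.
Proof.
move=> jk; pose v := C *m delta_mx j (0 : 'I_1).
have E z (s : R) : m + C *m (z + s *: delta_mx j 0) = m + C *m z + s *: v.
  by rewrite mulmxDr -scalemxAr addrA.
have vE l : v l 0 = C l j.
  rewrite mxE (bigD1 j) //= mxE !eqxx mulr1 big1 ?addr0 // => i ij.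
  by rewrite mxE (negbTE ij) mulr0.
have IHC : has_expectation stdg
    (fun z => \sum_l C l j * hess lbar (m + C *m z) k l).
  by apply: has_expectation_sum => l _; apply/has_expectationZ/has_expectation_hess.
have dG z (s : R) : is_derive s (1 : R)
    (fun s : R => grad lbar (m + C *m (z + s *: delta_mx j 0)) k 0)
    (\sum_l C l j * hess lbar (m + C *m (z + s *: delta_mx j 0)) k l).
  rewrite (_ : (fun _ : R => _) = fun s : R =>
      grad lbar (m + C *m z + s *: v) k 0); last first.
    by apply/funext => t; rewrite E.
  have := is_derive_grad lbar_C2 k (m + C *m z) v s.
  by rewrite E; under eq_bigr do rewrite vE mulrC.
have cH z : continuous (fun s : R =>
    \sum_l C l j * hess lbar (m + C *m (z + s *: delta_mx j 0)) k l).
  have [_ _ ch] := lbar_C2.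
  move=> s; apply: cvg_big => [x|l _]; first exact: add_continuous.
  apply: cvgM; first exact: cvg_cst.
  under eq_cvg do rewrite E; rewrite E.
  apply: (@cvg_comp _ _ _ (fun s : R => hess lbar (m + C *m z + s *: v))
    (fun M : 'M[R]_d => M k l)); last exact: coord_continuous.
  apply: (@cvg_comp _ _ _ (fun s : R => m + C *m z + s *: v) (hess lbar)); last exact: ch.
  by apply: cvgD; [exact: cvg_cst|apply: cvgZ; [exact: cvg_id|exact: cvg_cst]].
rewrite (stein (has_expectation_grad k) IHC (has_expectation_coord_grad jk) dG cH).
rewrite expectation_sum => [|l]; last exact/has_expectationZ/has_expectation_hess.
rewrite mxE; apply: eq_bigr => l _.
rewrite expectationZ; last exact: has_expectation_hess.
by rewrite mxE (expectation_affine OmC) // mulrC.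
Qed.

(** Integrate strong convexity at [m + C *m z] along [n + W *m z]. The logarithms are kept exact,
    since the Polyak-Lojasiewicz inequality exploits their curvature. *)
Lemma free_energy_ge (m' : 'cV[R]_d) (C' : 'M[R]_d) : Omega (m', C') ->
  dotv g (m' - m) + \sum_k \sum_j (H *m C) k j * (C' - C) k j
  + delta / 2 * (dotv (m' - m) (m' - m) + \sum_k \sum_j (C' - C) k j ^+ 2)
  - (ln (\prod_i C' i i) - ln (\prod_i C i i))
  <= free_energy lbar (m', C') - free_energy lbar (m, C).
Proof.
move=> O'; have [I ->] := free_energyB Z_gt0 KL_fin OmC O'.
rewrite lerD2r /=; set n := m' - m; set W := C' - C.
(* Above the diagonal the coefficient vanishes, so the unknown integrability of [z j 0 * G k z] for
   [k < j] never arises. *)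
have tW (k j : 'I_d) : (k < j)%N -> W k j = 0.
  have [/is_trig_mxP tC _] := OmC; have [/is_trig_mxP tC' _] := O'.
  by move=> kj; rewrite !mxE [C' k j]tC' // [C k j]tC // subrr.
have J k j : has_expectation stdg (fun z => W k j * (z j 0 * G k z)) /\
    expectation stdg (fun z => W k j * (z j 0 * G k z)) = (H *m C) k j * W k j.
  have [kj|jk] := ltnP k j.
    rewrite tW // mulr0 (_ : (fun z => _) = fun=> 0).
      split; first exact: has_expectation_stdg_cst.
      exact: expectation_stdg_cst.
    by apply/funext => z; rewrite mul0r.
  have I1 := has_expectation_coord_grad jk.
  split; first exact: has_expectationZ.
  by rewrite expectationZ // expectation_coord_grad // mulrC.
have Jn k : has_expectation stdg (fun z => n k 0 * G k z).
  exact/has_expectationZ/has_expectation_grad.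
have JW k : has_expectation stdg (fun z => \sum_j W k j * (z j 0 * G k z)).
  by apply: has_expectation_sum => j _; have [] := J k j.
have JnW k := has_expectationD (Jn k) (JW k).
have JG := has_expectation_sum (fun k (_ : xpredT k) => JnW k).
have Q k := expectation_stdg_affine_sqr (n k 0) (W k).
have JQ := has_expectation_sum (fun k (_ : xpredT k) => (Q k).1).
have JZ := has_expectationZ (delta / 2) JQ.
have -> : dotv g n + \sum_k \sum_j (H *m C) k j * W k j
    + delta / 2 * (dotv n n + \sum_k \sum_j W k j ^+ 2)
  = expectation stdg (fun z =>
      \sum_k (n k 0 * G k z + \sum_j W k j * (z j 0 * G k z))
      + delta / 2 * \sum_k (n k 0 + \sum_j W k j * z j 0) ^+ 2).
  rewrite (expectationD JG JZ) (expectationZ _ JQ).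
  rewrite !expectation_sum //; last by move=> k; exact: (Q k).1.
  rewrite /dotv -!big_split /=; congr (_ + _ * _); apply: eq_bigr => k _.
    rewrite (expectationD (Jn k) (JW k)) expectation_sum; last first.
      by move=> j; exact: (J k j).1.
    congr (_ + _); last by apply: eq_bigr => j _; rewrite (J k j).2.
    rewrite expectationZ; last exact: has_expectation_grad.
    by rewrite mxE (expectation_affine OmC) // mulrC.
  by rewrite (Q k).2 expr2.
apply: le_expectation => //.
- by move=> z; exact/ltW/stdg_gt0.
- exact: (has_expectationD JG JZ).
move=> z; have := strongly_convex_le lbar_C2 convex (m + C *m z) (n + W *m z).
have -> : m + C *m z + (n + W *m z) = m' + C' *m z.
  by rewrite addrACA -mulmxDl /n /W (addrC m) subrK (addrC C) subrK.
rewrite -addrA -lerBrDl; apply: le_trans.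
rewrite le_eqVlt; apply/orP; left; apply/eqP; congr (_ + _ * _).
  apply: eq_bigr => k _; rewrite !mxE mulrDr mulrC; congr (_ + _).
  by rewrite mulr_sumr; apply: eq_bigr => j _; ring.
by apply: eq_bigr => k _; rewrite !mxE -expr2.
Qed.

End free_energy_convexity.

(** * The Polyak-Lojasiewicz inequality *)

Section scalar_inequality.
Variable R : realType.
Implicit Types x y a b : R.

Lemma le_of_derive_ge0 (f df : R -> R) a b : a <= b ->
  (forall x, a <= x <= b -> is_derive x (1 : R) f (df x)) ->
  (forall x, a <= x <= b -> 0 <= df x) -> f a <= f b.
Proof.
move=> ab dF df0.
have [||c cab e] := @MVT_segment R f df a b ab.
- move=> x; rewrite in_itv /= => /andP[ax xb]; apply: dF.
  by rewrite !ltW.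
- apply: derivable_within_continuous => x; rewrite in_itv /= => xab.
  exact: (@ex_derive _ _ _ _ _ _ _ (dF x xab)).
rewrite -subr_ge0 e mulr_ge0 ?subr_ge0 //; apply: df0.
by move: cab; rewrite in_itv.
Qed.

Lemma le_ln_subr1 y : 0 < y -> ln y <= y - 1.
Proof.
by move=> y0; have := expR_ge1Dx (ln y); rewrite lnK ?posrE //; lra.
Qed.

Lemma le_ln1D_quadratic x : -1 < x -> x <= 0 -> ln (1 + x) <= x - x ^+ 2 / 2.
Proof.
move=> x1 x0.
pose f y := ln (1 + y) - (y - y ^+ 2 / 2).
suff : f x <= f 0 by rewrite /f addr0 ln1 expr0n /=; lra.
apply: (@le_of_derive_ge0 f (fun y => (1 + y)^-1 - (1 - y))) => // y /andP[xy y0].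
  have d1 : is_derive (1 + y) (1 : R) (@ln R) (1 + y)^-1.
    by apply: is_derive1_ln; lra.
  have d2 : is_derive y (1 : R) (fun y : R => ln (1 + y)) (1 + y)^-1.
    by apply: is_derive_eq; rewrite /GRing.scale /=; ring.
  by apply: is_derive_eq; rewrite /GRing.scale /=; field; lra.
have -> : (1 + y)^-1 - (1 - y) = y ^+ 2 / (1 + y) by field; lra.
by rewrite divr_ge0 ?sqr_ge0 //; lra.
Qed.

(** The left-hand side is sinh (ln b), and sinh s <= s for s <= 0. *)
Lemma ge_ln_sinh b : 0 < b -> b <= 1 -> (b - b^-1) / 2 <= ln b.
Proof.
move=> b0 b1.
pose f y : R := (y - y^-1) / 2 - ln y.
suff : f b <= f 1 by rewrite /f ln1 invr1; lra.
apply: (@le_of_derive_ge0 f (fun y => (1 + y ^- 2) / 2 - y^-1)) => // y /andP[by_ y1].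
  have y0 : 0 < y by lra.
  have d1 := is_derive1_ln y0.
  have d2 : is_derive y (1 : R) (@GRing.inv R) (- y ^- 2).
    by apply: is_derive_eq; [apply: is_deriveV; lra|rewrite /GRing.scale /= mulr1].
  by apply: is_derive_eq; rewrite /GRing.scale /=; field; lra.
have y0 : 0 < y by lra.
have -> : (1 + y ^- 2) / 2 - y^-1 = (1 - y^-1) ^+ 2 / 2 by field; lra.
by rewrite divr_ge0 ?sqr_ge0.
Qed.

(** Tailored to the last case of [diagonal_inequality]: there [2 <= b * (2 + 3 * x)], so the
    fraction is at most [b * x / 2] and the bound becomes 2/3 x + 1/3 b x. *)
Lemma le_ln1D_rational x : 0 <= x ->
  ln (1 + x) <= 2 / 3 * x + 2 / 3 * (x / (2 + 3 * x)).
Proof.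
move=> x0.
pose f y : R := 2 / 3 * y + 2 / 3 * (y / (2 + 3 * y)) - ln (1 + y).
pose df y : R := 2 / 3 + 4 / 3 / (2 + 3 * y) ^+ 2 - (1 + y)^-1.
have dF y : 0 <= y <= x -> is_derive y (1 : R) f (df y).
  move=> /andP[y0 _].
  have d1 : is_derive (1 + y) (1 : R) (@ln R) (1 + y)^-1.
    by apply: is_derive1_ln; lra.
  have d2 : is_derive y (1 : R) (fun y : R => ln (1 + y)) (1 + y)^-1.
    by apply: is_derive_eq; rewrite /GRing.scale /=; ring.
  have d3 : is_derive y (1 : R) (fun y : R => (2 + 3 * y)^-1)
      (- 3 / (2 + 3 * y) ^+ 2).
    apply: is_derive_eq; first by apply: is_deriveV; lra.
    by rewrite /GRing.scale /=; field; lra.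
  by apply: is_derive_eq; rewrite /GRing.scale /= /df; field; lra.
have df0 y : 0 <= y <= x -> 0 <= df y.
  move=> /andP[y0 _].
  have -> : df y = (5 * y ^+ 2 + 6 * y ^+ 3) / ((2 + 3 * y) ^+ 2 * (1 + y)).
    by rewrite /df; field; lra.
  by rewrite divr_ge0 ?mulr_ge0 ?sqr_ge0 ?addr_ge0 ?mulr_ge0 ?exprn_ge0 //; lra.
have := le_of_derive_ge0 x0 dF df0.
by rewrite /f !(mulr0, mul0r, addr0) ln1; lra.
Qed.

(* For [b < 1] and [x > 0]: if [2 b^2 x^2 <= (1 - b)^2] the left-hand side is
   smallest at [a = b], and the claim becomes [(b - 1/b) / 2 <= ln b];
   otherwise [a x^2 / 2 + (1 - b)^2 / (4 a)] is bounded below by AM-GM. *)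
Lemma diagonal_inequality a b x : 0 < a -> a <= 1 -> a <= b -> 0 < 1 + x ->
  0 <= b * x + a / 2 * x ^+ 2 - ln (1 + x) + (b - 1) ^+ 2 / (4 * a).
Proof.
move=> a0 a1 ab x1.
have l1 := le_ln_subr1 x1.
have q0 : 0 <= (b - 1) ^+ 2 / (4 * a) by rewrite divr_ge0 ?sqr_ge0 //; lra.
have p0 : 0 <= a / 2 * x ^+ 2 by rewrite mulr_ge0 ?sqr_ge0 //; lra.
have [b1|b1] := leP 1 b.
  have [x0|x0] := leP 0 x; first by nra.
  (* Here [a <= 1] matters: the barrier contributes x^2 / 2, at least a x^2 / 2, which doubles the
     quadratic term and completes a square over [4 * a]. *)
  have l2 := @le_ln1D_quadratic x; have {}l2 := l2 ltac:(lra) ltac:(lra).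
  have sq : 0 <= (b - 1 + 2 * a * x) ^+ 2 / (4 * a) by rewrite divr_ge0 ?sqr_ge0 //; lra.
  have -> : (b - 1) ^+ 2 / (4 * a) = (b - 1 + 2 * a * x) ^+ 2 / (4 * a)
      - (b - 1) * x - a * x ^+ 2 by field; lra.
  have : a * x ^+ 2 <= x ^+ 2 by rewrite ler_piMl // sqr_ge0.
  by lra.
have [x0|x0] := leP x 0; first by nra.
have [A|B] := leP (2 * b ^+ 2 * x ^+ 2) ((1 - b) ^+ 2).
  have b0 : 0 < b by lra.
  have e : a / 2 * x ^+ 2 + (b - 1) ^+ 2 / (4 * a) =
      b / 2 * x ^+ 2 + (b - 1) ^+ 2 / (4 * b)
      + (b - a) * ((1 - b) ^+ 2 - 2 * a * b * x ^+ 2) / (4 * a * b).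
    by field; lra.
  have c0 : 0 <= (b - a) * ((1 - b) ^+ 2 - 2 * a * b * x ^+ 2) / (4 * a * b).
    rewrite divr_ge0 ?mulr_ge0 ?subr_ge0 //; try lra.
    apply: le_trans A; rewrite ler_wpM2r ?sqr_ge0 //; nra.
  (* The bound ln y <= y - 1 at y = b (1 + x)^2 reproduces exactly the terms of the case a = b that
     involve [x]; what remains is [ge_ln_sinh]. *)
  have Y0 : 0 < b * (1 + x) ^+ 2 by rewrite mulr_gt0 ?exprn_gt0.
  have := le_ln_subr1 Y0; rewrite lnM ?posrE ?exprn_gt0 // lnXn // mulr2n.
  have := ge_ln_sinh b0 (ltW b1).
  have -> : (b - b^-1) / 2 = - ((b - 1) ^+ 2 / (2 * b)) + b - 1 by field; lra.
  have -> : (b - 1) ^+ 2 / (2 * b) = 2 * ((b - 1) ^+ 2 / (4 * b)) by field; lra.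
  by move: e c0; set u := _ / (4 * b); set w := _ / (4 * a * b); set t := _ / (4 * a); lra.
(* AM-GM has the constant 1 / sqrt 2; 2/3 is a rational number just below it. *)
have am : 2 / 3 * (1 - b) * x <= a / 2 * x ^+ 2 + (b - 1) ^+ 2 / (4 * a).
  have -> : a / 2 * x ^+ 2 + (b - 1) ^+ 2 / (4 * a) = 2 / 3 * (1 - b) * x
    + ((1 - b - 4 / 3 * (a * x)) ^+ 2 + 2 / 9 * (a * x) ^+ 2) / (4 * a).
    by field; lra.
  rewrite lerDl divr_ge0 //; last by lra.
  by have := sqr_ge0 (a * x); have := sqr_ge0 (1 - b - 4 / 3 * (a * x)); lra.
have b0 : 0 < b by lra.
have bx0 : 0 < b * x by rewrite mulr_gt0.
(* The square root of [B], with 3/2 as a rational upper bound for sqrt 2. *)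
have B' : 2 * (1 - b) <= 3 * (b * x).
  rewrite leNgt; apply/negP => h.
  have : 0 < (2 * (1 - b) - 3 * (b * x)) * (2 * (1 - b) + 3 * (b * x)).
    by rewrite mulr_gt0 //; lra.
  by have := sqr_ge0 (b * x); lra.
have := le_ln1D_rational (ltW x0).
have : x / (2 + 3 * x) <= b * x / 2 by rewrite ler_pdivrMr; nra.
by lra.
Qed.

End scalar_inequality.

Section polyak_lojasiewicz.
Variable R : realType.

Lemma ln_prod (I : finType) (F : I -> R) : (forall i, 0 < F i) ->
  ln (\prod_i F i) = \sum_i ln (F i).
Proof.
move=> F0; suff [] : 0 < \prod_i F i /\ ln (\prod_i F i) = \sum_i ln (F i) by [].
elim/big_ind2 : _ => //; first by rewrite ln1.
by move=> x1 x2 y1 y2 [x0 <-] [y0 <-]; rewrite mulr_gt0 ?lnM ?posrE.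
Qed.

Variable d : nat.
Implicit Types (A B C X : 'M[R]_d).

Lemma trig_mulmx_diag C X i : is_trig_mx C -> is_trig_mx X ->
  (C *m X) i i = C i i * X i i.
Proof.
move=> /is_trig_mxP tC /is_trig_mxP tX; rewrite mxE (bigD1 i) //= big1 ?addr0 // => k.
rewrite neq_ltn => /orP[ki|ik]; first by rewrite tX ?mulr0.
by rewrite tC ?mul0r.
Qed.

Lemma trig_unitmx C : is_trig_mx C -> (forall i, 0 < C i i) -> C \in unitmx.
Proof.
move=> tC C0; rewrite unitmxE det_trig // unitfE gt_eqF //.
by apply: prodr_gt0 => i _.
Qed.

(** Forward substitution in C X = B, by strong induction on the row. *)
Lemma trig_invmx_mul C B : is_trig_mx C -> (forall i, 0 < C i i) ->
  is_trig_mx B -> is_trig_mx (invmx C *m B).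
Proof.
move=> tC C0 /is_trig_mxP tB; set X := invmx C *m B.
have CX : C *m X = B by rewrite /X mulKVmx // trig_unitmx.
apply/is_trig_mxP => i j ij; move: ij.
have [n] := ubnP i; elim: n i => // n IHn i; rewrite ltnS => ni ij.
have /matrixP /(_ i j) := CX; rewrite mxE tB // (bigD1 i) //= big1 ?addr0.
  by move/eqP; rewrite mulf_eq0 gt_eqF //= => /eqP.
move=> k; rewrite neq_ltn => /orP[ki|ik].
  by rewrite (IHn k (leq_trans ki ni) (ltn_trans ki ij)) mulr0.
by move/is_trig_mxP : tC => ->; rewrite ?mul0r.
Qed.

(** Adjointness of [C] and [C^T] for the Frobenius pairing, used to pass to the coordinates W = C
    X. *)
Lemma sum_mulmx A C X :
  \sum_k \sum_j A k j * (C *m X) k j = \sum_i \sum_j (C^T *m A) i j * X i j.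
Proof.
under eq_bigr do under eq_bigr do rewrite mxE mulr_sumr.
under [RHS]eq_bigr do under eq_bigr do rewrite mxE mulr_suml.
rewrite exchange_big /= [RHS]exchange_big /=; apply: eq_bigr => j _.
rewrite exchange_big /=; apply: eq_bigr => i _; apply: eq_bigr => k _.
by rewrite mxE mulrCA mulrA.
Qed.

Variables (lbar : 'cV[R]_d -> R) (delta : R).
Hypothesis lbar_C2 : twice_continuously_differentiable lbar.
Hypothesis delta_gt0 : 0 < delta.
Hypothesis convex : forall x, loewner_ge (hess lbar x) (delta%:M).
Hypothesis Z_gt0 : 0 < \int[lebesgue_cV R d]_y expR (- lbar y).
Hypothesis KL_fin : forall tau, Omega tau ->
  KL_finite (gauss tau) (posterior lbar).
Variables (m : 'cV[R]_d) (C : 'M[R]_d).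
Hypothesis OmC : Omega (m, C).
Hypothesis grad_fin : forall i,
  has_expectation (gauss (m, C)) (fun x => grad lbar x i 0).
Hypothesis hess_fin : forall i j,
  has_expectation (gauss (m, C)) (fun x => hess lbar x i j).
Local Notation H := (expected_hess lbar (m, C)).
Local Notation g := (expected_grad lbar (m, C)).
Let S := C^T *m H *m C - 1%:M.

Let SE i j : S i j = (C^T *m H *m C) i j - (i == j)%:R.
Proof. by rewrite [(_ - 1%:M) i j]mxE [(- 1%:M) i j]mxE [1%:M i j]mxE. Qed.

Let tC : is_trig_mx C. Proof. by have [] := OmC. Qed.
Let C_gt0 i : 0 < C i i. Proof. by have [_ /(_ i)] := OmC. Qed.

(** The differential of [free_energy] at (m, C) in the direction (n, W), entered as a formula: it
    serves only as a supporting functional. *)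
Definition linearized_energy (n : 'cV[R]_d) (W : 'M[R]_d) : R :=
  dotv g n + \sum_k \sum_j (H *m C) k j * W k j - \sum_i W i i / C i i.

Definition dissipation : R :=
  dotv g (C *m C^T *m g) + \sum_i \sum_j S i j * tril S i j.

Lemma sum_sqr_ge0 A : 0 <= \sum_k \sum_j A k j ^+ 2.
Proof. by do 2 apply: sumr_ge0 => ? _; exact: sqr_ge0. Qed.

(** Drop the quadratic term of [free_energy_ge] and linearize each logarithm by ln y <= y - 1. *)
Lemma linearized_energy_le m' C' : Omega (m', C') ->
  linearized_energy (m' - m) (C' - C) <=
  free_energy lbar (m', C') - free_energy lbar (m, C).
Proof.
move=> O'; have [_ /= C'0] := O'.
apply: le_trans (free_energy_ge lbar_C2 delta_gt0 convex Z_gt0 KL_fin OmC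
  grad_fin hess_fin O').
have q0 : 0 <= delta / 2 * (dotv (m' - m) (m' - m)
    + \sum_k \sum_j (C' - C) k j ^+ 2).
  rewrite mulr_ge0 ?addr_ge0 ?dotv_ge0 ?sum_sqr_ge0 // divr_ge0 // ltW //.
suff : ln (\prod_i C' i i) - ln (\prod_i C i i) <= \sum_i (C' - C) i i / C i i.
  by rewrite /linearized_energy; lra.
rewrite !ln_prod // -sumrB; apply: ler_sum => i _.
rewrite -ln_div ?posrE //; apply: le_trans (le_ln_subr1 _) _; first exact: divr_gt0.
by rewrite !mxE mulrBl divff // gt_eqF.
Qed.

(** For W = C X with X lower triangular, the part linear in W is the sum of [S i j * X i j], the
    logarithms supplying the identity matrix in [S]. The flow takes X = - tril S. *)
Lemma linearized_energy_flow : linearized_energy (- (C *m C^T *m g))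
  (C *m tril (1%:M - C^T *m H *m C)) = - dissipation.
Proof.
have -> : tril (1%:M - C^T *m H *m C) = - tril S.
  apply/matrixP => i j; rewrite -opprB -/S [LHS]mxE [RHS]mxE [in RHS]mxE.
  by rewrite ![(- S) _ _]mxE mulNr; do 2 case: ifP => _ //; rewrite oppr0.
have tS : is_trig_mx (- tril S).
  apply/is_trig_mxP => i j ij; rewrite [LHS]mxE [X in - X]mxE ltnNge ltnW //=.
  by rewrite -val_eqE /= ltn_eqF // oppr0.
rewrite /linearized_energy /dissipation sum_mulmx.
have -> : \sum_i (C *m - tril S) i i / C i i = \sum_i \sum_j (1%:M : 'M[R]_d) i j * (- tril S) i j.
  apply: eq_bigr => i _; rewrite trig_mulmx_diag // mulrAC divff ?gt_eqF //.
  rewrite mul1r (bigD1 i) //= [(1%:M : 'M[R]_d) i i]mxE eqxx mul1r big1 ?addr0 // => j ji.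
  by rewrite [(1%:M : 'M[R]_d) i j]mxE eq_sym (negbTE ji) mul0r.
rewrite -addrA -sumrB opprD; congr (_ + _).
  by rewrite /dotv -sumrN; apply: eq_bigr => i _; rewrite [(- (C *m C^T *m g)) i 0]mxE mulrN.
rewrite -sumrN; apply: eq_bigr => i _; rewrite -sumrB -sumrN.
apply: eq_bigr => j _; rewrite -mulrBl [(- tril S) i j]mxE mulrN mulmxA.
by rewrite /S [(_ - 1%:M) i j]mxE [(- 1%:M) i j]mxE.
Qed.

Lemma le_expected_hess (v : 'cV[R]_d) :
  delta * dotv v v <= \sum_i (\sum_j H i j * v j 0) * v i 0.
Proof.
have Ih i j := has_expectation_hess OmC hess_fin i j.
have I1 i : has_expectation (@stdg R d)
    (fun z => \sum_j v j 0 * hess lbar (m + C *m z) i j).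
  by apply: has_expectation_sum => j _; exact: has_expectationZ.
have I2 i := has_expectationZ (v i 0) (I1 i).
have I3 := has_expectation_sum (fun i (_ : xpredT i) => I2 i).
rewrite -(expectation_stdg_cst d (delta * _)).
have -> : \sum_i (\sum_j H i j * v j 0) * v i 0 = expectation (@stdg R d)
    (fun z => \sum_i v i 0 * \sum_j v j 0 * hess lbar (m + C *m z) i j).
  rewrite expectation_sum //; apply: eq_bigr => i _.
  rewrite expectationZ // mulrC expectation_sum; last by move=> j; exact: has_expectationZ.
  congr (_ * _); apply: eq_bigr => j _; rewrite expectationZ // mulrC.
  by rewrite [H i j]mxE (expectation_affine OmC).
apply: le_expectation => //; [|exact: has_expectation_stdg_cst|].
  by move=> z; exact/ltW/stdg_gt0.
move=> z; apply: le_trans (le_hess convex (m + C *m z) v) _.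
rewrite le_eqVlt; apply/orP; left; apply/eqP; apply: eq_bigr => i _.
by rewrite mulrC; congr (_ * _); apply: eq_bigr => j _; rewrite mulrC.
Qed.

Lemma tril_mul_ge0 A i j : 0 <= A i j * tril A i j.
Proof.
rewrite [tril _ _ _]mxE; case: ifP => _; first by rewrite -expr2 sqr_ge0.
case: ifP => _; last by rewrite mulr0.
by rewrite mulrA -expr2 divr_ge0 ?sqr_ge0.
Qed.

Variable lam : R.
Hypothesis lam_gt0 : 0 < lam.
Hypothesis V_ge : loewner_ge (C *m C^T) (lam%:M).

Lemma le_dotv_trmx (u : 'cV[R]_d) : lam * dotv u u <= dotv u (C *m C^T *m u).
Proof.
have [_ /(_ u)] := V_ge.
rewrite mulmxBr mulmxBl [X in 0 <= X]mxE [X in 0 <= _ + X]mxE subr_ge0.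
by rewrite mul_mx_scalar -scalemxAl mxE -dotvE -[u^T *m _ *m u]mulmxA -dotvE.
Qed.

(* [C C^T >= lam] transfers to [C^T C]: expand [|C v - lam u|^2 >= 0] for the
   [u] with [C^T u = v]. *)
Lemma le_dotv_mulmx (v : 'cV[R]_d) : lam * dotv v v <= dotv (C *m v) (C *m v).
Proof.
have uT : C^T \in unitmx by rewrite unitmx_tr trig_unitmx.
pose u := invmx C^T *m v.
have uv : C^T *m u = v by rewrite /u mulKVmx.
have h := le_dotv_trmx u.
have e1 : dotv u (C *m C^T *m u) = dotv v v.
  by rewrite -mulmxA dotvE mulmxA -[u^T *m C]trmxK trmx_mul trmxK uv -dotvE.
have e2 : dotv u (C *m v) = dotv v v by rewrite -e1 -mulmxA uv.
have := dotv_ge0 (C *m v - lam *: u).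
have -> : dotv (C *m v - lam *: u) (C *m v - lam *: u) =
    dotv (C *m v) (C *m v) - 2 * lam * dotv u (C *m v) + lam ^+ 2 * dotv u u.
  rewrite /dotv !mulr_sumr -sumrB -big_split /=; apply: eq_bigr => i _.
  by rewrite ![(C *m v - lam *: u) i 0]mxE ![(- (lam *: u)) i 0]mxE ![(lam *: u) i 0]mxE; ring.
have : lam ^+ 2 * dotv u u <= lam * dotv v v.
  by rewrite -e1 expr2 -mulrA ler_pM2l.
by rewrite e2; lra.
Qed.

Lemma le_sum_sqr_mulmx X :
  lam * (\sum_i \sum_j X i j ^+ 2) <= \sum_k \sum_j (C *m X) k j ^+ 2.
Proof.
rewrite exchange_big /= [leRHS]exchange_big /= mulr_sumr; apply: ler_sum => j _.
have := le_dotv_mulmx (col j X).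
have -> : dotv (col j X) (col j X) = \sum_i X i j ^+ 2.
  by apply: eq_bigr => i _; rewrite mxE.
have -> : dotv (C *m col j X) (C *m col j X) = \sum_k (C *m X) k j ^+ 2 => //.
apply: eq_bigr => k _; rewrite expr2.
have -> // : (C *m col j X) k 0 = (C *m X) k j.
by rewrite !mxE; apply: eq_bigr => l _; rewrite mxE.
Qed.

(** Test H on the i-th column of [C]. This is the hypothesis [a <= b] of [diagonal_inequality]. *)
Lemma le_diag_congruence i : delta * lam <= (C^T *m H *m C) i i.
Proof.
pose v : 'cV[R]_d := delta_mx i 0.
have v1 : dotv v v = 1.
  rewrite /dotv (bigD1 i) //= !mxE !eqxx mulr1 big1 ?addr0 // => j ji.
  by rewrite mxE (negbTE ji) mul0r.
have Cv k : (C *m v) k 0 = C k i.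
  rewrite mxE (bigD1 i) //= mxE !eqxx mulr1 big1 ?addr0 // => j ji.
  by rewrite mxE (negbTE ji) mulr0.
have := le_expected_hess (C *m v); have := le_dotv_mulmx v; rewrite v1 mulr1 => h1 h2.
have -> : (C^T *m H *m C) i i = \sum_k (\sum_j H k j * (C *m v) j 0) * (C *m v) k 0.
  rewrite -mulmxA mxE; apply: eq_bigr => k _; rewrite [C^T _ _]mxE Cv mulrC.
  by congr (_ * _); rewrite mxE; apply: eq_bigr => j _; rewrite Cv.
by apply: le_trans h2; rewrite ler_pM2l.
Qed.

Lemma dissipation_ge i : (S i i) ^+ 2 / 2 <= dissipation.
Proof.
rewrite /dissipation (bigD1 i) //= (bigD1 i) //=.
have -> : S i i * tril S i i = S i i ^+ 2 / 2.
  by rewrite [tril _ _ _]mxE ltnn eqxx mulrA -expr2.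
have q0 : 0 <= dotv g (C *m C^T *m g).
  by apply: le_trans (le_dotv_trmx _); rewrite mulr_ge0 ?dotv_ge0 // ltW.
have q1 : 0 <= \sum_(j | j != i) S i j * tril S i j.
  by apply: sumr_ge0 => j _; exact: tril_mul_ge0.
have q2 : 0 <= \sum_(k | k != i) \sum_j S k j * tril S k j.
  by do 2 apply: sumr_ge0 => ? _; exact: tril_mul_ge0.
by lra.
Qed.

Lemma polyak_lojasiewicz m' C' : delta * lam <= 1 -> Omega (m', C') ->
  2 * (delta * lam) * (free_energy lbar (m, C) - free_energy lbar (m', C'))
  <= dissipation.
Proof.
have arith (x y z u v w : R) :
  u <= v -> x + y + (z + u - w) <= x + z + (y + v) - w by lra.
move=> a1 O'; have [/= tC' C'0] := O'.
set a := delta * lam in a1 *.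
have a0 : 0 < a by rewrite mulr_gt0.
pose X := invmx C *m (C' - C).
have CX : C *m X = C' - C by rewrite /X mulKVmx // trig_unitmx.
have tX : is_trig_mx X.
  apply: trig_invmx_mul => //; apply/is_trig_mxP => i j ij.
  by move/is_trig_mxP : tC' => tC'; move/is_trig_mxP : tC => tC0;
    rewrite !mxE tC' // tC0 // subrr.
have C'E i : C' i i = C i i * (1 + X i i).
  by rewrite mulrDr mulr1 -trig_mulmx_diag // CX !mxE addrCA subrr addr0.
have X1 i : 0 < 1 + X i i by rewrite -(pmulr_rgt0 _ (C_gt0 i)) -C'E.
have := free_energy_ge lbar_C2 delta_gt0 convex Z_gt0 KL_fin OmC grad_fin hess_fin O'.
rewrite -CX sum_mulmx mulmxA.
have -> : ln (\prod_i C' i i) - ln (\prod_i C i i) = \sum_i ln (1 + X i i).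
  rewrite !ln_prod // -sumrB; apply: eq_bigr => i _.
  by rewrite C'E lnM ?posrE // addrC addKr.
set DF := (X in _ <= X); set n := m' - m; set P := C^T *m H *m C => main.
(* Completing the square in [n] leaves - |g|^2 / (2 delta), and V >= lam bounds |g|^2 by g^T V g /
   lam. *)
have hn : - (dotv g (C *m C^T *m g) / (2 * a)) <= dotv g n + delta / 2 * dotv n n.
  apply: le_trans (_ : - (dotv g g / (2 * delta)) <= _).
    rewrite lerN2 ler_pdivrMr; last by rewrite mulr_gt0.
    rewrite mulrAC ler_pdivlMr; last by rewrite mulr_gt0.
    rewrite (_ : _ * (2 * a) = lam * dotv g g * (2 * delta)); last by rewrite /a; ring.
    by rewrite ler_pM2r ?mulr_gt0 // le_dotv_trmx.
  rewrite /dotv mulr_suml -sumrN mulr_sumr -big_split /=; apply: ler_sum => i _.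
  rewrite -subr_ge0 (_ : _ - _ = (g i 0 + delta * n i 0) ^+ 2 / (2 * delta)).
    by rewrite divr_ge0 ?sqr_ge0 // mulr_ge0 // ltW.
  by field; rewrite gt_eqF.
have hX : - ((\sum_i \sum_j S i j * tril S i j) / (2 * a)) <=
    \sum_i \sum_j P i j * X i j + a / 2 * (\sum_i \sum_j X i j ^+ 2)
    - \sum_i ln (1 + X i i).
  rewrite mulr_suml -sumrN mulr_sumr -big_split -sumrB; apply: ler_sum => i _ /=.
  rewrite mulr_suml -sumrN mulr_sumr -big_split /= (bigD1 i) //=.
  rewrite [X in _ <= X - _](bigD1 i) //= [leRHS]addrAC; apply: lerD.
    have := diagonal_inequality a0 a1 (le_diag_congruence i) (X1 i).
    have -> : P i i - 1 = S i i by rewrite SE eqxx.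
    (* [tril] halves the diagonal, so the target has [4 * a] where completing the square would give
       [2 * a]; [diagonal_inequality] closes this gap. *)
    have -> : S i i * tril S i i / (2 * a) = S i i ^+ 2 / (4 * a).
      by rewrite [tril _ _ _]mxE ltnn eqxx; field; rewrite gt_eqF.
    by rewrite -/P -lerBlDr sub0r.
  apply: ler_sum => j ji; rewrite [tril _ _ _]mxE eq_sym (negbTE ji).
  case: ltnP => [_|ij]; last first.
    have {}ij : (i < j)%N by rewrite ltn_neqAle ij andbT eq_sym.
    by move/is_trig_mxP : tX => ->; rewrite // expr0n !mulr0 mul0r oppr0 addr0.
  have -> : S i j = P i j.
    by rewrite SE eq_sym (negbTE ji) subr0.
  rewrite -subr_ge0 (_ : _ - _ = (P i j + a * X i j) ^+ 2 / (2 * a)).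
    by rewrite divr_ge0 ?sqr_ge0 // mulr_ge0 // ltW.
  by field; rewrite gt_eqF.
have hC : a / 2 * (\sum_i \sum_j X i j ^+ 2) <=
    delta / 2 * \sum_k \sum_j (C *m X) k j ^+ 2.
  have e s : a / 2 * s = delta / 2 * (lam * s) by rewrite /a; ring.
  rewrite e ler_pM2l ?divr_gt0 //.
  exact: le_sum_sqr_mulmx.
rewrite mulrC -ler_pdivlMr ?mulr_gt0 // /dissipation mulrDl.
rewrite -[X in X <= _]opprB -/DF lerNl opprD; apply: le_trans (lerD hn hX) _.
apply: (le_trans _ main); rewrite mulrDr.
exact: arith.
Qed.

End polyak_lojasiewicz.

(** * The flow *)

Section dini_gronwall.
Variable R : realType.
Implicit Types (y u : R -> R) (k t s : R).

(* Consider the infimum of the [s] in [[0, T]] with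
   [u s - e s >= u T - e T]. *)
Lemma le_of_left_dini u :
  (forall t e, 0 < t -> 0 < e -> exists2 h, 0 < h & forall s, 0 <= s -> t - h < s ->
    s < t -> u t - e * (t - s) <= u s) ->
  (forall t e, 0 <= t -> 0 < e -> exists2 h, 0 < h & forall s, t < s -> s < t + h ->
    u s <= u t + e) ->
  forall T, 0 <= T -> u T <= u 0.
Proof.
move=> left right T T0; apply/ler_addgt0Pr => e e0.
pose e1 := e / (T + 1).
have e10 : 0 < e1 by rewrite divr_gt0 // ltr_pwDr.
have eT : e1 * T <= e.
  by rewrite /e1 mulrAC ler_pdivrMr ?ltr_pwDr // ler_pM2l // lerDl.
pose v s := u s - e1 * s.
suff : v T <= v 0 by rewrite /v mulr0 subr0; lra.
pose A := [set s | 0 <= s <= T /\ v T <= v s].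
have hA : has_inf A.
  split; first by exists T; rewrite /A /= T0 lexx.
  by exists 0 => s [/andP[]].
set s0 := inf A.
have A_ge s : A s -> s0 <= s by move=> As; apply: ge_inf => //; exact: hA.2.
have s00 : 0 <= s0 by apply: lb_le_inf; [exact: hA.1|move=> s [/andP[]]].
have s0T : s0 <= T by apply: A_ge; rewrite /A /= T0 lexx.
(* Right upper semicontinuity puts the infimum itself into [A]. *)
have vs0 : v T <= v s0.
  apply/ler_addgt0Pr => e2 e20.
  have [h h0 rh] := right s0 e2 s00 e20.
  have [s As ss] := inf_adherent h0 hA.
  have := A_ge s As; rewrite le_eqVlt => /predU1P[e3|s0s].
    by case: As => _; rewrite -e3; lra.
  have := rh s s0s ss; case: As => _; rewrite /v.
  have : e1 * s0 <= e1 * s by rewrite ler_pM2l // ltW.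
  by lra.
move: s00; rewrite le_eqVlt => /predU1P[e00|s0_gt0]; first by rewrite e00.
have [h h0 lh] := left s0 e1 s0_gt0 e10.
(* A nonnegative point left of [s0] and within reach of the left estimate: it lies in [A], against
   minimality. *)
pose s := Num.max (s0 / 2) (s0 - h / 2).
have s_lt : s < s0 by rewrite gt_max; apply/andP; split; lra.
have s_ge : 0 <= s by rewrite le_max; apply/orP; left; lra.
have s_gt : s0 - h < s by rewrite lt_max; apply/orP; right; lra.
have := lh s s_ge s_gt s_lt => us.
have : s0 <= s.
  apply: A_ge; split; first by rewrite s_ge /= ltW // (lt_le_trans s_lt).
  by apply: le_trans vs0 _; rewrite /v; lra.
by rewrite leNgt s_lt.
Qed.

(** For u s = exp (k s) y s and r = t - s, the bound exp (- k r) (1 + k r) >= 1 - (k r)^2 shows that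
    the growth of the weight and the decay of y cancel to first order. *)
Lemma gronwall_of_left_dini y k : 0 <= k -> (forall t, 0 <= t -> 0 <= y t) ->
  (forall t e, 0 < t -> 0 < e -> exists2 h, 0 < h & forall s, 0 <= s -> t - h < s ->
    s < t -> y t + (t - s) * (k * y t - e) <= y s) ->
  (forall t e, 0 <= t -> 0 < e -> exists2 h, 0 < h & forall s, t < s -> s < t + h ->
    y s <= y t + e) ->
  forall T, 0 <= T -> y T <= expR (- k * T) * y 0.
Proof.
have arith (a b c d f g : R) :
  a - b <= c -> d <= f -> b <= f -> g = f + f -> a - g <= c - d by lra.
move=> k0 y0 left right T T0.
pose u s := expR (k * s) * y s.
suff : u T <= u 0.
  rewrite /u mulr0 expR0 mul1r => h.
  by rewrite mulNr expRN mulrC ler_pdivlMr ?expR_gt0 // mulrC.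
apply: le_of_left_dini T0 => t e.
- move=> t0 e0; have yt := y0 t (ltW t0).
  pose E := expR (k * t); have E0 : 0 < E by exact: expR_gt0.
  have e10 : 0 < e / (2 * E) by rewrite divr_gt0 // mulr_gt0.
  have [h h0 lh] := left t _ t0 e10.
  pose M := k ^+ 2 * y t * E.
  have M0 : 0 <= M by rewrite !mulr_ge0 ?sqr_ge0 // ltW.
  (* The second-order error is M r^2, at most e r / 2 for r < h2; the tolerance e / (2 E) uses the
     other half. *)
  pose h2 := e / (2 * (M + 1)).
  have h20 : 0 < h2 by rewrite divr_gt0 // mulr_gt0 // ltr_pwDr.
  exists (Num.min h h2); first by rewrite lt_min h0.
  move=> s s0 ths st.
  have [sh sh2] : t - h < s /\ t - h2 < s.
    by move: ths; rewrite ltrBlDl -ltrBlDr lt_min => /andP[]; split; lra.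
  have := lh s s0 sh st; rewrite /u -/E.
  set r := t - s; have r0 : 0 < r by rewrite /r subr_gt0.
  have -> : expR (k * s) = E * expR (- (k * r)).
    by rewrite /E -expRD /r; congr expR; ring.
  set F := expR _; have F0 : 0 < F by exact: expR_gt0.
  have F1 : F <= 1 by rewrite /F -expR0 ler_expR oppr_le0 mulr_ge0 // ltW.
  have F2 : 1 - k * r <= F by exact: expR_ge1Dx.
  move=> ys.
  have h1 : E * F * (y t + r * (k * y t - e / (2 * E))) <= E * F * y s.
    by rewrite ler_pM2l // mulr_gt0.
  apply: le_trans h1.
  have -> : E * F * (y t + r * (k * y t - e / (2 * E))) =
      (F * (1 + k * r)) * (E * y t) - F * (e / 2 * r).
    by field; rewrite gt_eqF.
  have kr : 0 <= k * r by rewrite mulr_ge0 // ltW.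
  have h3 : 1 - (k * r) ^+ 2 <= F * (1 + k * r).
    rewrite (_ : 1 - _ = (1 - k * r) * (1 + k * r)); last by ring.
    by rewrite ler_wpM2r // addr_ge0.
  have h4 : (1 - (k * r) ^+ 2) * (E * y t) <= F * (1 + k * r) * (E * y t).
    by rewrite ler_wpM2r // mulr_ge0 // ltW.
  have h5 : F * (e / 2 * r) <= e / 2 * r.
    by rewrite ler_piMl // mulr_ge0 ?divr_ge0 // ltW.
  have h6 : (k * r) ^+ 2 * (E * y t) <= e / 2 * r.
    rewrite (_ : _ * (E * y t) = M * r * r); last by rewrite /M; ring.
    rewrite ler_pM2r //; apply: le_trans (_ : (M + 1) * h2 <= _).
      by apply: ler_pM => //; [exact: ltW|rewrite lerDl|rewrite /r ltW //; lra].
    by rewrite /h2 le_eqVlt; apply/orP; left; apply/eqP; field; lra.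
  rewrite mulrBl mul1r in h4.
  by apply: (arith _ _ _ _ _ _ h4 h5 h6); field.
- move=> t0 e0; pose E := expR (k * t); have E0 : 0 < E by exact: expR_gt0.
  have e10 : 0 < e / (2 * E) by rewrite divr_gt0 // mulr_gt0.
  have [h h0 rh] := right t _ t0 e10.
  pose c := y t + e / (2 * E).
  have ct : (fun s : R => expR (k * s) * c) s @[s --> t] --> expR (k * t) * c.
    apply: cvgM; last exact: cvg_cst.
    apply: (@cvg_comp _ _ _ (fun s : R => k * s) expR); last exact: continuous_expR.
    by apply: cvgM; [exact: cvg_cst|exact: cvg_id].
  have cE : expR (k * t) * c = u t + e / 2.
    by rewrite /u -/E /c; field; rewrite gt_eqF.
  have lte : expR (k * t) * c < u t + e by rewrite cE; lra.
  have /nbhs_ballP[h2 /= h20 bh] :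
    \forall s \near t, expR (k * s) * c < u t + e by exact: (cvgr_lt _ ct).
  exists (Num.min h h2); first by rewrite lt_min h0.
  move=> s ts sth.
  have [sh sh2] : s < t + h /\ s < t + h2.
    by move: sth; rewrite -ltrBlDl lt_min => /andP[]; split; lra.
  apply: le_trans (_ : expR (k * s) * c <= _).
    by rewrite ler_pM2l ?expR_gt0 // rh.
  apply/ltW/bh; rewrite /ball /= ltr_norml; apply/andP; split; lra.
Qed.

End dini_gronwall.

(** Little-o form of the derivative, multiplied out so that [s = t] is allowed, with one radius for
    all entries. *)
Lemma has_derive_nneg_entry (R : realType) p q (c : R -> 'M[R]_(p, q)) (t : R) v :
  has_derive_nneg c t v -> forall e, 0 < e -> exists2 h, 0 < h &
    forall s, 0 <= s -> `|s - t| < h ->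
    forall i j, `|(c s - c t) i j - (s - t) * v i j| <= e * `|s - t|.
Proof.
move=> dc e e0.
have H i j : exists2 h, 0 < h & forall s, 0 <= s -> `|s - t| < h ->
    `|(c s - c t) i j - (s - t) * v i j| <= e * `|s - t|.
  have cij : (fun h : R => (h^-1 *: (c (t + h) - c t)) i j) h
      @[h --> within [set h | 0 <= t + h] (0 : R)^'] --> v i j.
    apply: (@cvg_comp _ _ _ (fun h : R => h^-1 *: (c (t + h) - c t))
      (fun M : 'M[R]_(p, q) => M i j)); first exact: dc.
    exact: coord_continuous.
  have /cvgrPdist_lt /(_ e e0) := cij.
  rewrite /within /= => /nbhs_ballP[h /= h0 bh]; exists h => // s s0 sth.
  have [->|st] := eqVneq s t; first by rewrite !subrr mul0r mxE subr0 !normr0 mulr0.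
  have sh : ball (0 : R) h (s - t) by rewrite /ball /= sub0r normrN.
  have := bh _ sh; rewrite subr_eq0 => /(_ st).
  rewrite [t + _]addrC subrK => /(_ s0).
  have n0 : 0 < `|s - t| by rewrite normr_gt0 subr_eq0.
  rewrite [((s - t)^-1 *: (c s - c t)) i j]mxE => /ltW; rewrite -(@ler_pM2l _ `|s - t|) // -normrM.
  rewrite mulrBr mulrA divff ?subr_eq0 // mul1r distrC => /le_trans; apply.
  by rewrite mulrC.
have /choice[hh hhP] : forall ij : 'I_p * 'I_q, exists h, 0 < h /\
    forall s, 0 <= s -> `|s - t| < h ->
    `|(c s - c t) ij.1 ij.2 - (s - t) * v ij.1 ij.2| <= e * `|s - t|.
  by move=> ij; have [h h0 hP] := H ij.1 ij.2; exists h.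
(* The default 1 keeps the radius positive even for an empty matrix. *)
exists (\big[Num.min/1]_ij hh ij).
  by apply: lt_bigmin => // ij _; have [] := hhP ij.
move=> s s0 st i j; have [_] := hhP (i, j); apply=> //.
by apply: lt_le_trans st _; apply: bigmin_le_cond.
Qed.

(** * Bounds on the linearization and local upper bounds on the free energy *)

Section linearized_energy_bounds.
Variables (R : realType) (d : nat) (lbar : 'cV[R]_d -> R).
Implicit Types (m n : 'cV[R]_d) (C W : 'M[R]_d).

Lemma linearized_energyB m C n n' W W' (r : R) :
  linearized_energy lbar m C (n - r *: n') (W - r *: W') =
  linearized_energy lbar m C n W - r * linearized_energy lbar m C n' W'.
Proof.
rewrite /linearized_energy.
have -> : dotv (expected_grad lbar (m, C)) (n - r *: n') =
    dotv (expected_grad lbar (m, C)) n - r * dotv (expected_grad lbar (m, C)) n'.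
  rewrite /dotv mulr_sumr -sumrB; apply: eq_bigr => i _.
  by rewrite [(n - _) i 0]mxE [(- (r *: n')) i 0]mxE [(r *: n') i 0]mxE; ring.
set A := expected_hess lbar (m, C) *m C.
have WE k j : (W - r *: W') k j = W k j - r * W' k j by rewrite !mxE.
have -> : \sum_k \sum_j A k j * (W - r *: W') k j =
    \sum_k \sum_j A k j * W k j - r * \sum_k \sum_j A k j * W' k j.
  rewrite mulr_sumr -sumrB; apply: eq_bigr => k _.
  by rewrite mulr_sumr -sumrB; apply: eq_bigr => j _; rewrite WE; ring.
have -> : \sum_i (W - r *: W') i i / C i i =
    \sum_i W i i / C i i - r * \sum_i W' i i / C i i.
  by rewrite mulr_sumr -sumrB; apply: eq_bigr => i _; rewrite WE; ring.
by ring.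
Qed.

(** Bounds the l^1 norm of the coefficients of the linearization, which is dual to the entrywise
    maximum norm. *)
Definition linearized_energy_norm m C : R :=
  \sum_i `|expected_grad lbar (m, C) i 0|
  + \sum_k \sum_j `|(expected_hess lbar (m, C) *m C) k j| + \sum_i `|(C i i)^-1|.

Lemma linearized_energy_norm_ge0 m C : 0 <= linearized_energy_norm m C.
Proof. by rewrite !addr_ge0 // sumr_ge0 // => i _; rewrite sumr_ge0. Qed.

Lemma norm_linearized_energy_le m C n W (e : R) :
  (forall i, `|n i 0| <= e) -> (forall k j, `|W k j| <= e) ->
  `|linearized_energy lbar m C n W| <= linearized_energy_norm m C * e.
Proof.
move=> ne We; rewrite /linearized_energy /linearized_energy_norm !mulrDl.
apply: le_trans (ler_normB _ _) _; apply: lerD; last first.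
  rewrite mulr_suml; apply: le_trans (ler_norm_sum _ _ _) _; apply: ler_sum => i _.
  by rewrite normrM mulrC ler_wpM2l.
apply: le_trans (ler_normD _ _) _; apply: lerD.
  rewrite mulr_suml; apply: le_trans (ler_norm_sum _ _ _) _; apply: ler_sum => i _.
  by rewrite normrM ler_wpM2l.
rewrite mulr_suml; apply: le_trans (ler_norm_sum _ _ _) _; apply: ler_sum => k _.
rewrite mulr_suml; apply: le_trans (ler_norm_sum _ _ _) _; apply: ler_sum => j _.
by rewrite normrM ler_wpM2l.
Qed.

Lemma linearized_energy_sum m C n W :
  linearized_energy lbar m C n W =
  \sum_i n i 0 * linearized_energy lbar m C (delta_mx i 0) 0
  + \sum_k \sum_j W k j * linearized_energy lbar m C 0 (delta_mx k j).
Proof.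
have e1 i : linearized_energy lbar m C (delta_mx i 0) 0 =
    expected_grad lbar (m, C) i 0.
  rewrite /linearized_energy /dotv (bigD1 i) //= big1 => [|k ki]; last first.
    by rewrite [delta_mx _ _ _ _]mxE (negbTE ki) mulr0.
  rewrite [delta_mx _ _ _ _]mxE !eqxx mulr1 !big1 ?addr0 ?subr0 // => k _.
    by rewrite mxE mul0r.
  by rewrite big1 // => j _; rewrite [(0 : 'M[R]_d) k j]mxE mulr0.
have e2 k j : linearized_energy lbar m C 0 (delta_mx k j) =
    (expected_hess lbar (m, C) *m C) k j - (k == j)%:R / C k k.
  rewrite /linearized_energy /dotv big1 ?add0r => [|i _]; last first.
    by rewrite [(0 : 'cV[R]_d) i 0]mxE mulr0.
  congr (_ - _).
    rewrite (bigD1 k) //= (bigD1 j) //= [delta_mx _ _ _ _]mxE !eqxx mulr1.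
    rewrite !big1 ?addr0 // => [l lk|l lj]; last first.
      by rewrite [delta_mx _ _ _ _]mxE (negbTE lj) andbF mulr0.
    by apply: big1 => i _; rewrite [delta_mx _ _ _ _]mxE (negbTE lk) mulr0.
  rewrite (bigD1 k) //= mxE eqxx big1 ?addr0 // => i ik.
  by rewrite mxE (negbTE ik) mul0r.
rewrite {1}/linearized_energy -addrA; congr (_ + _).
  by apply: eq_bigr => i _; rewrite e1 mulrC.
rewrite -sumrB; apply: eq_bigr => k _.
under [RHS]eq_bigr do rewrite e2 mulrBr.
rewrite sumrB; congr (_ - _); first by apply: eq_bigr => j _; rewrite mulrC.
rewrite (bigD1 k) //= eqxx mul1r big1 ?addr0 // => j jk.
by rewrite eq_sym (negbTE jk) mul0r mulr0.
Qed.

Variable delta : R.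
Hypothesis lbar_C2 : twice_continuously_differentiable lbar.
Hypothesis delta_gt0 : 0 < delta.
Hypothesis convex : forall x, loewner_ge (hess lbar x) (delta%:M).
Hypothesis Z_gt0 : 0 < \int[lebesgue_cV R d]_y expR (- lbar y).
Hypothesis KL_fin : forall tau, Omega tau ->
  KL_finite (gauss tau) (posterior lbar).
Variable Fmin : R.
Hypothesis Fmin_le : forall tau, Omega tau -> Fmin <= free_energy lbar tau.

Variables (m0 : 'cV[R]_d) (C0 : 'M[R]_d).
Hypothesis OmC0 : Omega (m0, C0).
Local Notation F := (free_energy lbar).
(** Half the diagonal entry, so that moving an entry of row [k] in the lower triangle of [C0] by
    [rho k] either way stays in [Omega]. [Mm] and [MC] bound the height above [Fmin] of the free
    energy at these test points. *)
Let rho k := C0 k k / 2.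
Let Mm i := `|F (m0 + delta_mx i 0, C0)| + `|F (m0 - delta_mx i 0, C0)| - Fmin.
Let MC k j := `|F (m0, C0 + rho k *: delta_mx k j)|
  + `|F (m0, C0 - rho k *: delta_mx k j)| - Fmin.
Let N := \sum_(i < d) 1 + \sum_k \sum_(j < d) (rho k)^-1.
Let B := \sum_i `|Mm i| + \sum_k \sum_j `|MC k j| / rho k.

Let rho_gt0 k : 0 < rho k.
Proof. by have [_ /= C00] := OmC0; rewrite /rho divr_gt0. Qed.

(* The linearization at a nearby point [(m, C)] is controlled by the values of
   the free energy at finitely many fixed points around [(m0, C0)]. *)
Lemma free_energy_local_upper : exists K : R, exists2 r : R, 0 < r &
  forall m C (e : R), Omega (m, C) ->
  (forall i, has_expectation (gauss (m, C)) (fun x => grad lbar x i 0)) ->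
  (forall i j, has_expectation (gauss (m, C)) (fun x => hess lbar x i j)) ->
  0 <= e -> e < r ->
  (forall i, `|(m - m0) i 0| <= e) -> (forall k j, `|(C - C0) k j| <= e) ->
  F (m, C) <= F (m0, C0) + K * e.
Proof.
have arith (x L a b M : R) : x - L <= a - Fmin -> - x - L <= b - Fmin ->
    0 <= a -> 0 <= b -> a + b - Fmin <= M -> `|x| <= M + L.
  by rewrite ler_norml; lra.
have arith2 (x y b u v : R) : x - y <= u -> u <= b + v -> v <= 1 / 2 * u ->
    x <= y + 2 * b by lra.
have arith4 (x : R) : 0 < x / 2 -> x / 2 < x by lra.
have arith3 (x y : R) : 0 <= x -> x * (2 * (y + 1)) <= 1 -> x * y <= 1 / 2 by lra.
have N0 : 0 <= N.
  rewrite addr_ge0 // sumr_ge0 // => k _.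
  by rewrite sumr_ge0 // => j _; rewrite invr_ge0 ltW.
(* The proof reaches L <= e B + e N L for the slope [L]; this radius gives e N <= 1/2, and absorbing
   leaves L <= 2 B e. *)
exists (2 * B); exists (1 / (2 * (N + 1))).
  by rewrite divr_gt0 // mulr_gt0 // ltr_pwDr.
move=> m C e O gf hf e0 er me Ce.
have lin := linearized_energy_le lbar_C2 delta_gt0 convex Z_gt0 KL_fin O gf hf.
pose l n W := linearized_energy lbar m C n W.
pose L := l (m - m0) (C - C0).
have l00 : l 0 0 = 0.
  rewrite /l linearized_energy_sum !big1 ?addr0 // => [k _|i _]; last first.
    by rewrite mxE mul0r.
  by apply: big1 => j _; rewrite mxE mul0r.
have lN (r : R) n W : l (- (r *: n)) (- (r *: W)) = - (r * l n W).
  by have := linearized_energyB m C 0 n 0 W r; rewrite !sub0r -!/(l _ _) l00 sub0r.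
(* Convexity is applied at the moving point (m, C) and tested at (m0, C0), so [L] involves the
   uncontrolled differential at (m, C). *)
have EL : F (m, C) - F (m0, C0) <= L.
  have := lin _ _ OmC0; rewrite -(opprB m m0) -(opprB C C0).
  have := lN 1 (m - m0) (C - C0); rewrite !scale1r mul1r /l => ->.
  by rewrite -/(l _ _) -/L lerNl opprB.
have linD n W : Omega (m0 + n, C0 + W) -> l n W - L <= `|F (m0 + n, C0 + W)| - Fmin.
  move=> On; have := lin _ _ On.
  have -> : m0 + n - m = n - 1 *: (m - m0) by rewrite scale1r opprB [RHS]addrC addrAC.
  have -> : C0 + W - C = W - 1 *: (C - C0) by rewrite scale1r opprB [RHS]addrC addrAC.
  rewrite linearized_energyB mul1r => /le_trans; apply.
  by apply: lerB; [exact: ler_norm|exact: Fmin_le].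
have lZ (r : R) n W : l (r *: n) (r *: W) = r * l n W.
  by have := lN (- r) n W; rewrite !scaleNr !opprK mulNr opprK.
(* Testing in both directions bounds the absolute value, at the price of [L] on the right. *)
have lm i : `|l (delta_mx i 0) 0| <= `|Mm i| + L.
  have O1 n : Omega (m0 + n, C0 + 0) by rewrite addr0; exact: OmC0.
  have h1 := linD _ _ (O1 (delta_mx i 0)).
  have h2 := linD _ _ (O1 (- delta_mx i 0)).
  have := lN 1 (delta_mx i 0) 0; rewrite !scale1r oppr0 mul1r => e1.
  rewrite e1 !addr0 in h1 h2.
  exact: arith h1 h2 (normr_ge0 _) (normr_ge0 _) (ler_norm _).
have lC (k j : 'I_d) : (j <= k)%N ->
    `|l 0 (delta_mx k j)| <= (`|MC k j| + L) / rho k.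
  move=> jk; have nr : `|rho k| < C0 k k.
    by rewrite gtr0_norm //; exact: arith4 (rho_gt0 k).
  have O1 : Omega (m0 + 0, C0 + rho k *: delta_mx k j).
    by rewrite addr0; exact: Omega_delta.
  have O2 : Omega (m0 + 0, C0 - rho k *: delta_mx k j).
    by rewrite addr0 -scaleNr; apply: Omega_delta => //; rewrite normrN.
  have h1 := linD _ _ O1; have h2 := linD _ _ O2.
  have e1 := lN (rho k) 0 (delta_mx k j); have e2 := lZ (rho k) 0 (delta_mx k j).
  rewrite !scaler0 ?oppr0 in e1 e2.
  rewrite e1 e2 !addr0 in h1 h2.
  rewrite ler_pdivlMr // -[X in _ * X](gtr0_norm (rho_gt0 k)) -normrM mulrC.
  exact: arith h1 h2 (normr_ge0 _) (normr_ge0 _) (ler_norm _).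
have [L0|L0] := leP L 0.
  have BB : 0 <= B.
    rewrite addr_ge0 ?sumr_ge0 // => k _; rewrite sumr_ge0 // => j _.
    by rewrite divr_ge0 // ltW.
  apply: le_trans (_ : F (m0, C0) <= _).
    by rewrite -subr_le0; exact: le_trans EL L0.
  by rewrite lerDl !mulr_ge0.
have LB : L <= e * B + e * N * L.
  have -> : e * B + e * N * L = \sum_i e * (`|Mm i| + L)
      + \sum_k \sum_j e * ((`|MC k j| + L) / rho k).
    have s1 : \sum_i e * (`|Mm i| + L) = e * (\sum_i `|Mm i|) + e * (\sum_(i < d) 1) * L.
      rewrite -mulr_sumr big_split /= mulrDr -mulrA; congr (_ + _ * _).
      by rewrite mulr_suml; apply: eq_bigr => i _; rewrite mul1r.
    have s2 : \sum_k \sum_j e * ((`|MC k j| + L) / rho k) =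
        e * (\sum_k \sum_j `|MC k j| / rho k) + e * (\sum_k \sum_(j < d) (rho k)^-1) * L.
      under eq_bigr do rewrite -mulr_sumr.
      rewrite -mulr_sumr -mulrA -mulrDr mulr_suml -big_split; congr (_ * _).
      apply: eq_bigr => k _; rewrite mulr_suml -big_split; apply: eq_bigr => j _ /=.
      by rewrite mulrDl (mulrC L).
    by rewrite s1 s2 /B /N; ring.
  rewrite {1}/L /l linearized_energy_sum; apply: lerD.
    apply: ler_sum => i _; apply: le_trans (ler_norm _) _; rewrite normrM.
    by apply: ler_pM.
  apply: ler_sum => k _; apply: ler_sum => j _.
  have [jk|kj] := leqP j k.
    by apply: le_trans (ler_norm _) _; rewrite normrM; apply: ler_pM => //; exact: lC.
  have -> : (C - C0) k j = 0.
    have [/is_trig_mxP tC _] := O; have [/is_trig_mxP tC0 _] := OmC0.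
    by rewrite !mxE [C k j]tC // [C0 k j]tC0 // subrr.
  rewrite mul0r; apply: mulr_ge0 => //; apply: divr_ge0; last exact/ltW/rho_gt0.
  by apply: addr_ge0 => //; exact: ltW.
have eN : e * N <= 1 / 2.
  apply: arith3 => //; rewrite -ler_pdivlMr; first exact: ltW.
  by rewrite mulr_gt0 // ltr_pwDr.
have h : e * N * L <= 1 / 2 * L by rewrite ler_pM2r.
by rewrite -mulrA [B * e]mulrC; exact: arith2 EL LB h.
Qed.

End linearized_energy_bounds.

Lemma subrZ_entry (R : pzRingType) p q (A V : 'M[R]_(p, q)) (r : R) i j :
  (A - r *: V) i j = A i j - r * V i j.
Proof. by rewrite !mxE. Qed.

Section natural_gradient_flow.
Variables (R : realType) (d : nat) (lbar : 'cV[R]_d -> R) (delta : R).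
Variables (m : R -> 'cV[R]_d) (C : R -> 'M[R]_d) (Fmin : R).
Hypothesis lbar_C2 : twice_continuously_differentiable lbar.
Hypothesis delta_gt0 : 0 < delta.
Hypothesis convex : forall x, loewner_ge (hess lbar x) (delta%:M).
Hypothesis Z_gt0 : 0 < \int[lebesgue_cV R d]_y expR (- lbar y).
Hypothesis KL_fin : forall tau, Omega tau ->
  KL_finite (gauss tau) (posterior lbar).
Hypothesis Fmin_le : forall tau, Omega tau -> Fmin <= free_energy lbar tau.
Hypothesis Omega_flow : forall t : R, 0 <= t -> Omega (m t, C t).
Hypothesis grad_fin : forall t : R, 0 <= t -> forall i,
  has_expectation (gauss (m t, C t)) (fun x => grad lbar x i 0).
Hypothesis hess_fin : forall t : R, 0 <= t -> forall i j,
  has_expectation (gauss (m t, C t)) (fun x => hess lbar x i j).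
Hypothesis flow_C : forall t : R, 0 <= t -> has_derive_nneg C t
  (C t *m tril (1%:M - (C t)^T *m expected_hess lbar (m t, C t) *m C t)).
Hypothesis flow_m : forall t : R, 0 <= t -> has_derive_nneg m t
  (- (C t *m (C t)^T *m expected_grad lbar (m t, C t))).

Let E t := free_energy lbar (m t, C t).
Let D t := dissipation lbar (m t) (C t).

Lemma flow_entries (t e : R) : 0 <= t -> 0 < e -> exists2 h, 0 < h &
  forall s, 0 <= s -> `|s - t| < h ->
  (forall i, `|(m s - m t - (s - t) *:
    - (C t *m (C t)^T *m expected_grad lbar (m t, C t))) i 0| <= e * `|s - t|) /\
  (forall i j, `|(C s - C t - (s - t) *: (C t *m tril (1%:M -
    (C t)^T *m expected_hess lbar (m t, C t) *m C t))) i j| <= e * `|s - t|).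
Proof.
move=> t0 e0.
have [h1 h10 H1] := has_derive_nneg_entry (flow_m t0) e0.
have [h2 h20 H2] := has_derive_nneg_entry (flow_C t0) e0.
exists (Num.min h1 h2); first by rewrite lt_min h10.
move=> s s0; rewrite lt_min => /andP[st1 st2]; split=> [i|i j].
  by rewrite subrZ_entry; exact: H1.
by rewrite subrZ_entry; exact: H2.
Qed.

(* Convexity bounds [E s] from below by the linearization at time [t]: this
   controls the left derivative without differentiating under the integral. *)
Lemma flow_left_dini (t e : R) : 0 < t -> 0 < e -> exists2 h, 0 < h &
  forall s, 0 <= s -> t - h < s -> s < t -> E t + (t - s) * (D t - e) <= E s.
Proof.
move=> t0 e0; have t0' := ltW t0.
pose K := linearized_energy_norm lbar (m t) (C t).
have K0 : 0 <= K := linearized_energy_norm_ge0 lbar (m t) (C t).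
have arith (x y z r k f : R) : x <= y - z -> `|x - (- r) * - f| <= k -> k <= e * r ->
    z + r * (f - e) <= y by rewrite ler_norml; lra.
have e10 : 0 < e / (K + 1) by rewrite divr_gt0 // ltr_pwDr.
have [h h0 H] := flow_entries t0' e10; exists h => // s s0 ths st.
have ts : `|s - t| = t - s by rewrite distrC gtr0_norm // subr_gt0.
have [|Hm HC] := H s s0; first by rewrite ts; lra.
have lo := linearized_energy_le lbar_C2 delta_gt0 convex Z_gt0 KL_fin
  (Omega_flow t0') (grad_fin t0') (hess_fin t0') (Omega_flow s0).
have := norm_linearized_energy_le lbar (m t) (C t) Hm HC.
rewrite linearized_energyB (linearized_energy_flow lbar (Omega_flow t0')) ts -/K -/(D t).
rewrite -[s - t]opprB => di; apply: arith lo di _.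
rewrite mulrA ler_wpM2r //; first by rewrite subr_ge0 ltW.
by rewrite mulrA ler_pdivrMr ?ltr_pwDr // mulrC ler_pM2l // lerDl.
Qed.

(** The linearization at time [t] bounds later energies only from below, so upper control needs
    [free_energy_local_upper]. At t = 0 it also ties the flow to its initial value. *)
Lemma flow_right_usc (t e : R) : 0 <= t -> 0 < e -> exists2 h, 0 < h &
  forall s, t < s -> s < t + h -> E s <= E t + e.
Proof.
move=> t0 e0.
have [K [r r0 up]] := free_energy_local_upper lbar_C2 delta_gt0 convex Z_gt0
  KL_fin Fmin_le (Omega_flow t0).
have [h h0 H] := flow_entries t0 ltr01.
pose vm := - (C t *m (C t)^T *m expected_grad lbar (m t, C t)).
pose vC := C t *m tril (1%:M - (C t)^T *m expected_hess lbar (m t, C t) *m C t).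
(* [M] exceeds the modulus of each velocity entry by at least the derivative tolerance 1, so every
   entry moves by at most [M * (s - t)]. *)
pose M := 1 + \sum_i `|vm i 0| + \sum_i \sum_j `|vC i j|.
have sum_ge (I : finType) (f : I -> R) i : (forall i, 0 <= f i) -> f i <= \sum_i f i.
  by move=> f0; rewrite (bigD1 i) //= lerDl sumr_ge0.
have sm0 : 0 <= \sum_i `|vm i 0| by exact: sumr_ge0.
have sC0 : 0 <= \sum_i \sum_j `|vC i j| by do 2 (apply: sumr_ge0 => ? _).
have M0 : 0 < M by rewrite /M -addrA ltr_pwDl // addr_ge0.
have Mm i : `|vm i 0| + 1 <= M.
  have := sum_ge _ (fun i => `|vm i 0|) i (fun=> normr_ge0 _) => h1.
  by rewrite /M addrC -addrA lerD2l (le_trans h1) // lerDl.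
have MC i j : `|vC i j| + 1 <= M.
  have h1 := sum_ge _ (fun j => `|vC i j|) j (fun=> normr_ge0 _).
  have h2 : \sum_j `|vC i j| <= \sum_i \sum_j `|vC i j|.
    by apply: (sum_ge _ (fun i => \sum_j `|vC i j|)) => k; exact: sumr_ge0.
  rewrite /M addrC -addrA lerD2l (le_trans h1) // (le_trans h2) //.
  by rewrite lerDr.
pose q := Num.min h (Num.min (r / M) (e / ((`|K| + 1) * M))).
exists q.
  by rewrite !lt_min h0 !divr_gt0 // mulr_gt0 // ltr_pwDr.
move=> s ts; rewrite -ltrBlDl !lt_min => /and3P[sh sr se].
have s0 : 0 <= s by apply: le_trans t0 _; exact: ltW.
have st0 : 0 < s - t by rewrite subr_gt0.
have ns : `|s - t| = s - t by rewrite gtr0_norm.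
have [|Hm HC] := H s s0; first by rewrite ns.
have close (x v : R) : `|v| + 1 <= M ->
    `|x - (s - t) * v| <= 1 * `|s - t| -> `|x| <= M * (s - t).
  move=> vM; rewrite mul1r ns => xv.
  rewrite -[x](subrK ((s - t) * v)); apply: le_trans (ler_normD _ _) _.
  apply: le_trans (lerD xv (lexx _)) _; rewrite normrM ns.
  rewrite (_ : s - t + _ = (`|v| + 1) * (s - t)); last by ring.
  by rewrite ler_pM2r.
have := up (m s) (C s) (M * (s - t)) (Omega_flow s0) (grad_fin s0) (hess_fin s0).
have b1 : 0 <= M * (s - t) by rewrite mulr_ge0 // ltW.
have b2 : M * (s - t) < r by rewrite mulrC -ltr_pdivlMr.
have b3 i : `|(m s - m t) i 0| <= M * (s - t).
  by apply: close (Mm i) _; have := Hm i; rewrite subrZ_entry.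
have b4 i j : `|(C s - C t) i j| <= M * (s - t).
  by apply: close (MC i j) _; have := HC i j; rewrite subrZ_entry.
move=> /(_ b1 b2 b3 b4) /le_trans; apply; rewrite lerD2l.
apply: le_trans (_ : (`|K| + 1) * (M * (s - t)) <= _).
  by rewrite ler_wpM2r // (le_trans (ler_norm _)) // lerDl.
rewrite mulrA mulrC -ler_pdivlMr; first exact: ltW.
by rewrite mulr_gt0 // ltr_pwDr.
Qed.

Variable lam : R.
Hypothesis lam_gt0 : 0 < lam.
Hypothesis V_ge : forall t : R, 0 <= t -> loewner_ge (C t *m (C t)^T) (lam%:M).

(* Otherwise the dissipation would stay bounded away from [0] although the free
   energy is bounded below. *)
Lemma flow_curvature_le1 (i : 'I_d) : delta * lam <= 1.
Proof.
rewrite leNgt; apply/negP => a1; pose a := delta * lam.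
pose c := (a - 1) ^+ 2 / 2.
have c0 : 0 < c by rewrite divr_gt0 // exprn_gt0 // subr_gt0.
have Dc t : 0 <= t -> c <= D t.
  move=> t0; have O := Omega_flow t0.
  apply: (le_trans _ (dissipation_ge lbar (m t) lam_gt0 (V_ge t0) i)).
  have := le_diag_congruence delta_gt0 convex O (hess_fin t0) lam_gt0 (V_ge t0) i.
  set P := (_ *m _ *m _) => aP.
  have S1 (Q : 'M[R]_d) : (Q - 1%:M) i i = Q i i - 1 by rewrite !mxE eqxx.
  rewrite S1.
  have c1 : 0 <= a - 1 by rewrite subr_ge0 ltW.
  have c2 : a - 1 <= P i i - 1 by rewrite lerD2r.
  by rewrite ler_pM2r ?invr_gt0 // lerXn2r ?nnegrE // (le_trans c1).
(* At this time [E 0 - c * T] equals [Fmin - 1]. *)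
have [T T0 TE] : exists2 T, 0 <= T & E 0 - c * T < Fmin.
  exists ((E 0 - Fmin + 1) / c).
    by rewrite divr_ge0 ?(ltW c0) // addr_ge0 // subr_ge0; apply/Fmin_le/Omega_flow.
  rewrite mulrCA divff ?gt_eqF // mulr1 opprD opprB addrA [_ + (_ - _)]addrC subrK.
  by rewrite ltrBlDr ltrDl.
have arith (x y r k u v s t : R) : x + r * (u - k) <= y -> 0 < r -> v <= u ->
    r = t - s -> x + v * t - k * r <= y + v * s by nra.
have arith2 (x y e u v : R) : x <= y + e / 2 -> u - v < e / 2 ->
    x + u <= y + v + e by lra.
have arith3 (x y k : R) : x + k <= y + c * 0 -> y - k < x -> False.
  by rewrite mulr0; lra.
have dec : E T + c * T <= E 0 + c * 0.
  apply: (@le_of_left_dini R (fun t => E t + c * t)) => //.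
  - move=> t e t0 e0; have [h h0 H] := flow_left_dini t0 e0.
    exists h => // s s0 hs st.
    by apply: arith (H s s0 hs st) _ (Dc t (ltW t0)) _; rewrite ?subr_gt0.
  - move=> t e t0 e0; have e20 : 0 < e / 2 by rewrite divr_gt0.
    have [h h0 H] := flow_right_usc t0 e20.
    exists (Num.min h (e / 2 / c)); first by rewrite lt_min h0 divr_gt0.
    move=> s ts; rewrite -ltrBlDl lt_min => /andP[sh sc].
    have := H s ts; rewrite -ltrBlDl => /(_ sh) => h1.
    move: sc; rewrite ltr_pdivlMr // mulrC mulrBr => h2.
    exact: arith2 h1 h2.
have FT := Fmin_le (Omega_flow T0).
exact: arith3 dec (lt_le_trans TE FT).
Qed.

Lemma flow_exponential_decay (i : 'I_d) (T : R) : 0 <= T ->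
  (exists2 tau, Omega tau & free_energy lbar tau = Fmin) ->
  E T - Fmin <= expR (- (2 * (delta * lam)) * T) * (E 0 - Fmin).
Proof.
move=> T0 [[m' C'] O' EF].
have a1 := flow_curvature_le1 i.
have arith (x y z r u v e : R) : x + r * (u - e) <= y -> 0 < r -> v <= u ->
    x - z + r * (v - e) <= y - z by nra.
apply: (@gronwall_of_left_dini R (fun t => E t - Fmin)) => //.
- by rewrite !mulr_ge0 ?ltW.
- by move=> t t0; rewrite subr_ge0; apply/Fmin_le/Omega_flow.
- move=> t e t0 e0; have [h h0 H] := flow_left_dini t0 e0.
  exists h => // s s0 hs st; apply: arith (H s s0 hs st) _ _; first by rewrite subr_gt0.
  have t0' := ltW t0; rewrite -EF.
  exact: (polyak_lojasiewicz lbar_C2 delta_gt0 convex Z_gt0 KL_fin (Omega_flow t0')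
    (grad_fin t0') (hess_fin t0') lam_gt0 (V_ge t0')).
- move=> t e t0 e0; have [h h0 H] := flow_right_usc t0 e0.
  by exists h => // s ts sh; rewrite addrAC lerD2r H.
Qed.

End natural_gradient_flow.

(** * Conclusion *)

Lemma frobenius_dim_gt0 (R : realType) d (A : 'M[R]_d) : 0 < frobenius A -> (0 < d)%N.
Proof. by case: d A => // A; rewrite /frobenius big_ord0 sqrtr0 ltxx. Qed.

Theorem theorem1 (R : realType) (d : nat) (lbar : 'cV[R]_d -> R) (delta : R)
    (mstar : 'cV[R]_d) (Cstar : 'M[R]_d)
    (m : R -> 'cV[R]_d) (C : R -> 'M[R]_d)
    (xi_l xi_u lambda_min : R)
    (lbar_C2 : twice_continuously_differentiable lbar)
    (delta_gt0 : 0 < delta)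
    (lbar_strongly_convex : forall x, loewner_ge (hess lbar x) (delta%:M))
    (Omega_star : Omega (mstar, Cstar))
    (minimizer_star : forall tau, Omega tau ->
      (KL (gauss (mstar, Cstar)) (posterior lbar)
       <= KL (gauss tau) (posterior lbar))%E)
    (KL_fin : forall tau, Omega tau -> KL_finite (gauss tau) (posterior lbar))
    (Omega_flow : forall t : R, 0 <= t -> Omega (m t, C t))
    (grad_fin : forall t : R, 0 <= t -> forall i,
      has_expectation (gauss (m t, C t)) (fun x => grad lbar x i 0))
    (hess_fin : forall t : R, 0 <= t -> forall i j,
      has_expectation (gauss (m t, C t)) (fun x => hess lbar x i j))
    (flow_C : forall t : R, 0 <= t -> has_derive_nneg C t
      (C t *m tril (1%:M - (C t)^T *m expected_hess lbar (m t, C t) *m C t)))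
    (flow_m : forall t : R, 0 <= t -> has_derive_nneg m t
      (- (C t *m (C t)^T *m expected_grad lbar (m t, C t))))
    (xi_l_gt0 : 0 < xi_l) (xi_le : xi_l <= xi_u)
    (C_bounds : forall t : R, 0 <= t -> xi_l <= frobenius (C t) <= xi_u)
    (lambda_min_gt0 : 0 < lambda_min)
    (V_bound : forall t : R, 0 <= t ->
      loewner_ge (C t *m (C t)^T) (lambda_min%:M)) :
  let mu := delta * Num.min lambda_min (lambda_min ^+ 2 / 2) in
  forall t : R, 0 <= t ->
  (KL (gauss (m t, C t)) (posterior lbar)
     - KL (gauss (mstar, Cstar)) (posterior lbar)
   <= (expR (- 2 * mu * t)%R)%:E *
      (KL (gauss (m 0%R, C 0%R)) (posterior lbar)
         - KL (gauss (mstar, Cstar)) (posterior lbar)))%E.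
Proof.
move=> mu t t0.
(* In dimension 0 the Frobenius norm is an empty sum, contradicting [xi_l_gt0]; the bound on delta
   lambda needs a diagonal index. *)
have d0 : (0 < d)%N.
  by apply: frobenius_dim_gt0 (C 0) _; have /andP[/(lt_le_trans xi_l_gt0)] := C_bounds 0 (lexx 0).
pose i := Ordinal d0.
(* The real-valued integral is 0 by default when the extended one is infinite. That case is settled
   by default values: the posterior becomes 0 by division by 0, ln 0 = 0, and every divergence
   vanishes. *)
have [Z0|Z0] := ltP 0 (\int[lebesgue_cV R d]_y expR (- lbar y)); last first.
  have post0 : posterior lbar = fun=> 0.
    apply/funext => x; rewrite /posterior (_ : Rintegral _ _ _ = 0) ?invr0 ?mulr0 //.
    apply/eqP; rewrite eq_le Z0 /=; apply: Rintegral_ge0 => y _; exact: expR_ge0.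
  have KL0 q : KL q (posterior lbar) = 0%E.
    rewrite /KL post0; under eq_integral do rewrite invr0 mulr0 ln0 // mulr0.
    exact: integral0.
  by rewrite !KL0 sube0 mule0.
have Fmin_le tau : Omega tau ->
    free_energy lbar (mstar, Cstar) <= free_energy lbar tau.
  move=> O; have := minimizer_star tau O.
  by rewrite (free_energyE KL_fin Omega_star) (free_energyE KL_fin O) lee_fin.
rewrite (free_energyE KL_fin Omega_star) (free_energyE KL_fin (Omega_flow t t0)).
rewrite (free_energyE KL_fin (Omega_flow 0 (lexx 0))).
have EFin_le (a b c k : R) : a - b <= k * (c - b) ->
    (a%:E - b%:E <= k%:E * (c%:E - b%:E))%E.
  by rewrite -lee_fin.
apply: EFin_le.
apply: le_trans (flow_exponential_decay lbar_C2 delta_gt0 lbar_strongly_convex Z0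
  KL_fin Fmin_le Omega_flow grad_fin hess_fin flow_C flow_m lambda_min_gt0 V_bound
  i t0 _) _; first by exists (mstar, Cstar).
apply: ler_wpM2r; first by rewrite subr_ge0; exact/Fmin_le/Omega_flow.
have mu_le : mu <= delta * lambda_min by rewrite /mu ler_pM2l // ge_min lexx.
by rewrite ler_expR ler_wpM2r // mulNr lerN2 ler_pM2l.
Qed.
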